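(* Let $T_1>0$. Suppose there exist positive constants $D,\delta,C_H,C_1,C_2,C_3,C_4,a_{\mathcal{G}}$ such that the following hold. (a) For any compact $I\subset(0,\infty)$ and any $y\in\mathbb{R}^d$, $r>0$, $P^0(X^{(n)}_t\in H(y,r))\to\int_{H(y,r)}k^{(D)}_t(y')\,dy'$ as $n\to\infty$, uniformly for $t\in I$. (b) $\hat p_k(0,x)\le C_2k^{-d/2}\exp(-C_4d_{\mathcal{G}}(0,x)^2/k)$ for all $k\ge C_3$ and $x\in\mathcal{G}$. (c) For each $y\in\mathcal{G}$ there exists $s(y)<\infty$ such that the parabolic Harnack inequality holds with constant $C_H$ for $Q(y,R,R^2)$ for all $R\ge s(y)$. (d) $\lim_{r\to\infty}h(r)/r=0$, where $h(r)$ is the supremum of the $r'$ such that $\Lambda(y,r')=\emptyset$ for some $y\in H(0,r)$. (e) For each $x\in\mathbb{Q}^d$: for any $r>0$, $\mu(\Lambda_n(x,r))/(2n^{1/2}r)^d\to a_{\mathcal{G}}$ as $n\to\infty$; for each $r>0$ there exists $n_0$ such that for $n\ge n_0$, $|x'-y'|_\infty\le d_{\mathcal{G}}(x',y')\le(C_1|x'-y'|_\infty)\vee n^{1/2-\delta}$ for all $x',y'\in\Lambda_n(x,r)$; and $n^{-1/2}s(g_n(x))\to0$ as $n\to\infty$. Then $$\lim_{n\to\infty}\ \sup_{x\in\mathbb{R}^d}\ \sup_{t\ge T_1}\big|n^{d/2}\,\hat p_{nt}(0,g_n(x))-2a_{\mathcal{G}}^{-1}k^{(D)}_t(x)\big|=0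 .$$
   Context: Setting. $d\ge2$; $\mathcal{G}$ is an infinite connected subgraph of the nearest-neighbour lattice $\mathbb{Z}^d$ (its vertex set is also denoted $\mathcal{G}$) with $0\in\mathcal{G}$; $d_{\mathcal{G}}$ is the graph distance in $\mathcal{G}$ and $B(x,r)=\{y\in\mathcal{G}:d_{\mathcal{G}}(x,y)<r\}$; $x\sim y$ means $\{x,y\}$ is an edge of $\mathcal{G}$. For $A\subset\mathcal{G}$, $\overline A$ is the union of $A$ and the set of vertices of $\mathcal{G}\setminus A$ having a neighbour in $A$. Conductances $\mu_{xy}=\mu_{yx}$ on $\mathcal{G}\times\mathcal{G}$ satisfy $\mu_{xy}=0$ if $x\neq y$ and $x\not\sim y$, $0<C_M^{-1}\le\mu_{xy}\le C_M$ if $x\sim y$, $0\le\mu_{xx}\le C_M$ for all $x$; $\mu_x=\sum_y\mu_{xy}$, $\mu(A)=\sum_{x\in A}\mu_x$, and $\mu(B(x,r))\le C_Ur^d$ for $r\ge1$, $x\in\mathcal{G}$, where $C_M,C_U$ are constants. $X=(X_n,n\in\mathbb{Z}_+,P^x,x\in\mathcal{G})$ is the Markov chain with transition probabilities $\mu_{xy}/\mu_x$, $p_n(x,y)=P^x(X_n=y)/\mu_y$, and for real $t\ge0$, $\hat p_t(x,y)=p_{\lfloor t\rfloor}(x,y)+p_{\lfloor t\rfloor+1}(x,y)$. Notation. $k^{(D)}_t(x)=(2\pi tD)^{-d/2}e^{-|x|^2/(2Dt)}$; $X^{(n)}_t=n^{-1/2}X_{\lfloor nt\rfloor}$; $H(x,r)=x+[-r,r]^d$,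 $\Lambda(x,r)=H(x,r)\cap\mathcal{G}$, $\Lambda_n(x,r)=\Lambda(xn^{1/2},rn^{1/2})$; $g_n(x)$ is a closest point of $\mathcal{G}$ to $n^{1/2}x$ in the $|\cdot|_\infty$ norm (ties broken by a fixed ordering of $\mathbb{Z}^d$); $s\vee t=\max(s,t)$. Parabolic Harnack inequality (PHI). Let $\mathcal{L}f(x)=\mu_x^{-1}\sum_y\mu_{xy}(f(y)-f(x))$, $Q=Q(x,R,T)=(0,T]\times B(x,R)$, $Q_-=[\frac14T,\frac12T]\times B(x,\frac12R)$, $Q_+=[\frac34T,T]\times B(x,\frac12R)$. $u$ is caloric on $Q$ if it is defined on $([0,T]\cap\mathbb{Z})\times\overline{B(x,R)}$ and $u(n+1,y)-u(n,y)=\mathcal{L}u(n,y)$ for integers $0\le n\le T-1$, $y\in B(x,R)$. The PHI holds with constant $C_H$ for $Q$ if for all non-negative $u$ caloric on $Q$, with $\hat u(n,y)=u(n+1,y)+u(n,y)$, $\sup_{Q_-}\hat u\le C_H\inf_{Q_+}\hat u$ (over integers $n$ with $n+1\le T$). *)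

(* Defs.v *)
From HB Require Import structures.
From mathcomp Require Import all_boot all_order all_algebra.
From mathcomp Require Import all_classical all_reals all_analysis.

Set Implicit Arguments.
Unset Strict Implicit.
Unset Printing Implicit Defensive.
Import Order.TTheory GRing.Theory Num.Theory.
Import numFieldNormedType.Exports.
Local Open Scope classical_set_scope.
Local Open Scope ring_scope.

(* Not assumed to be an induced subgraph: [edge] may omit lattice edges between
   two vertices of [vset]. *)
Record lattice_graph (d : nat) := LatticeGraph {
  vset : set 'rV[int]_d;
  edge : rel 'rV[int]_d;
  edge_sym : symmetric edge;
  edge_vset : forall x y, edge x y -> vset x;
  edge_nn : forall x y, edge x y -> \sum_i `|x 0 i - y 0 i| = 1
}.

Definition walk_of_length d (G : lattice_graph d) (x y : 'rV[int]_d) (n : nat)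
  : Prop :=
  exists p : seq 'rV[int]_d, [/\ path (edge G) x p, last x p = y & size p = n].

Definition graph_connected d (G : lattice_graph d) : Prop :=
  forall x y, vset G x -> vset G y -> exists n, walk_of_length G x y n.

(* The value is 0 when no walk joins x to y; this does not occur between
   vertices of a connected graph. *)
Definition gdist d (G : lattice_graph d) (x y : 'rV[int]_d) : nat :=
  if pselect (exists n, `[< walk_of_length G x y n >]) is left h
  then ex_minn h else 0%N.

Definition gball (R : realType) d (G : lattice_graph d) (x : 'rV[int]_d)
    (r : R) : set 'rV[int]_d :=
  [set y | vset G y /\ (gdist G x y)%:R < r].

Definition vclosure d (G : lattice_graph d) (A : set 'rV[int]_d)
  : set 'rV[int]_d :=
  A `|` [set y | [/\ vset G y, ~ A y & exists2 x, A x & edge G y x]].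

(* [\sum_(y \in A)] is the sum over [A] of a function with finite
    support in [A]; by [cond_zero] every sum over a neighbourhood below is of
    this kind, and [vol] is only applied to bounded sets. *)

Record conductances (R : realType) d (G : lattice_graph d) (CM : R)
    (mu : 'rV[int]_d -> 'rV[int]_d -> R) : Prop := Conductances {
  cond_CM : 0 < CM;
  cond_sym : forall x y, vset G x -> vset G y -> mu x y = mu y x;
  cond_zero : forall x y, vset G x -> vset G y ->
    x != y -> ~~ edge G x y -> mu x y = 0;
  cond_edge : forall x y, edge G x y -> CM^-1 <= mu x y <= CM;
  cond_diag : forall x, vset G x -> 0 <= mu x x <= CM
}.

Definition vweight (R : realType) d (G : lattice_graph d)
    (mu : 'rV[int]_d -> 'rV[int]_d -> R) (x : 'rV[int]_d) : R :=
  \sum_(y \in vset G) mu x y.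

Definition vol (R : realType) d (G : lattice_graph d)
    (mu : 'rV[int]_d -> 'rV[int]_d -> R) (A : set 'rV[int]_d) : R :=
  \sum_(x \in A) vweight G mu x.

(* [chain_step] is P^x(X_{n+1} = z_{n+1} | X_0 = z_0, ..., X_n = z_n) =
   mu_{z_n z_{n+1}} / mu_{z_n}, multiplied out. *)
Record markov_chain (R : realType) d (G : lattice_graph d)
    (mu : 'rV[int]_d -> 'rV[int]_d -> R)
    (disp : measure_display) (Omega : measurableType disp)
    (P : 'rV[int]_d -> probability Omega R)
    (X : nat -> Omega -> 'rV[int]_d) : Prop := MarkovChain {
  chain_meas : forall n y, measurable [set w | X n w = y];
  chain_state : forall n w, vset G (X n w);
  chain_init : forall x, vset G x -> P x [set w | X 0%N w = x] = 1%E;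
  chain_step : forall x, vset G x ->
    forall (n : nat) (z : nat -> 'rV[int]_d), (forall i, vset G (z i)) ->
    P x [set w | forall i, (i <= n.+1)%N -> X i w = z i] =
    (P x [set w | forall i, (i <= n)%N -> X i w = z i]
     * (mu (z n) (z n.+1) / vweight G mu (z n))%:E)%E
}.

Definition heat_kernel (R : realType) d (G : lattice_graph d)
    (mu : 'rV[int]_d -> 'rV[int]_d -> R)
    (disp : measure_display) (Omega : measurableType disp)
    (P : 'rV[int]_d -> probability Omega R)
    (X : nat -> Omega -> 'rV[int]_d)
    (n : nat) (x y : 'rV[int]_d) : R :=
  fine (P x [set w | X n w = y]) / vweight G mu y.

(* [Num.truncn t] is the floor of [t] when [0 <= t]. *)
Definition heat_kernel_hat (R : realType) d (G : lattice_graph d)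
    (mu : 'rV[int]_d -> 'rV[int]_d -> R)
    (disp : measure_display) (Omega : measurableType disp)
    (P : 'rV[int]_d -> probability Omega R)
    (X : nat -> Omega -> 'rV[int]_d)
    (t : R) (x y : 'rV[int]_d) : R :=
  heat_kernel G mu P X (Num.truncn t) x y
  + heat_kernel G mu P X (Num.truncn t).+1 x y.

(* The norm [`|x|] of a row vector is its l-infinity norm. *)

Definition emb (R : realType) d (x : 'rV[int]_d) : 'rV[R]_d :=
  map_mx intr x.

Definition cube (R : realType) d (x : 'rV[R]_d) (r : R) : set 'rV[R]_d :=
  [set y | forall i, x 0 i - r <= y 0 i <= x 0 i + r].

Definition Lam (R : realType) d (G : lattice_graph d) (x : 'rV[R]_d) (r : R)
  : set 'rV[int]_d :=
  [set z | vset G z /\ cube x r (emb R z)].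

Definition Lam_n (R : realType) d (G : lattice_graph d) (n : nat)
    (x : 'rV[R]_d) (r : R) : set 'rV[int]_d :=
  Lam G (Num.sqrt n%:R *: x) (r * Num.sqrt n%:R).

Definition rescaled (R : realType) d (disp : measure_display)
    (Omega : measurableType disp) (X : nat -> Omega -> 'rV[int]_d)
    (n : nat) (t : R) (w : Omega) : 'rV[R]_d :=
  (Num.sqrt n%:R)^-1 *: emb R (X (Num.truncn (n%:R * t)) w).

Definition hole (R : realType) d (G : lattice_graph d) (r : R) : R :=
  sup [set r' : R | exists2 y : 'rV[R]_d, cube 0 r y & Lam G y r' = set0].

Definition closest_spec (R : realType) d (G : lattice_graph d)
    (le : rel 'rV[int]_d) (x : 'rV[R]_d) (z : 'rV[int]_d) : Prop :=
  [/\ vset G z,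
      forall z', vset G z' -> `|emb R z - x| <= `|emb R z' - x| &
      forall z', vset G z' -> `|emb R z' - x| = `|emb R z - x| -> le z z'].

Definition closest (R : realType) d (G : lattice_graph d)
    (le : rel 'rV[int]_d) (n : nat) (x : 'rV[R]_d) : 'rV[int]_d :=
  xget 0 [set z | closest_spec G le (Num.sqrt n%:R *: x) z].

(* Lebesgue measure on R^d, carried by [d.-tuple R] because ['rV[R]_d] has no
    measurable structure; it is the d-fold product measure. *)

Definition tuple_cons_pair (R : realType) d
    (p : (d.-tuple (measurableTypeR R) * measurableTypeR R)%type)
  : d.+1.-tuple (measurableTypeR R) := [the d.+1.-tuple _ of p.2 :: p.1].

Lemma measurable_tuple_cons_pair (R : realType) d :
  measurable_fun setT (@tuple_cons_pair R d).
Proof. exact: measurable_cons. Qed.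

(* [pushforward (m \x lebesgue_measure) tuple_cons_pair], with its measure
   structure given explicitly because it depends on a measurability proof. *)
Definition lebesgue_cons (R : realType) d
    (m : {measure set (d.-tuple (measurableTypeR R)) -> \bar R})
  : {measure set (d.+1.-tuple (measurableTypeR R)) -> \bar R} :=
  measure_function_pushforward__canonical__measure_function_Measure
    (m \x @lebesgue_measure R)%E (@measurable_tuple_cons_pair R d).

Fixpoint lebesgue_tuple (R : realType) (d : nat)
  : {measure set (d.-tuple (measurableTypeR R)) -> \bar R} :=
  match d with
  | 0%N => \d_ ([tuple] : 0.-tuple (measurableTypeR R))
  | d'.+1 => lebesgue_cons (lebesgue_tuple R d')
  end.

Definition row_of_tuple (R : realType) d (v : d.-tuple (measurableTypeR R))
  : 'rV[R]_d := \row_i tnth v i.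

Definition integral_cube (R : realType) d (y : 'rV[R]_d) (r : R)
    (f : 'rV[R]_d -> R) : R :=
  \int[lebesgue_tuple R d]_(v in [set v | cube y r (row_of_tuple v)])
    f (row_of_tuple v).

Definition l2norm (R : realType) d (x : 'rV[R]_d) : R :=
  Num.sqrt (\sum_i x 0 i ^+ 2).

Definition gauss (R : realType) d (D t : R) (x : 'rV[R]_d) : R :=
  (2 * pi * t * D) `^ (- (d%:R / 2)) * expR (- (l2norm x ^+ 2 / (2 * D * t))).

Definition laplacian (R : realType) d (G : lattice_graph d)
    (mu : 'rV[int]_d -> 'rV[int]_d -> R) (f : 'rV[int]_d -> R)
    (x : 'rV[int]_d) : R :=
  (vweight G mu x)^-1 * \sum_(y \in vset G) (mu x y * (f y - f x)).

(* [u] is a total function, but only its values on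
   {0, ..., floor T} x closure of B(x, rho) are constrained here and in [PHI]. *)
Definition caloric (R : realType) d (G : lattice_graph d)
    (mu : 'rV[int]_d -> 'rV[int]_d -> R) (x : 'rV[int]_d) (rho T : R)
    (u : nat -> 'rV[int]_d -> R) : Prop :=
  forall n y, n%:R <= T - 1 -> gball G x rho y ->
    u n.+1 y - u n y = laplacian G mu (u n) y.

Definition PHI (R : realType) d (G : lattice_graph d)
    (mu : 'rV[int]_d -> 'rV[int]_d -> R) (CH : R)
    (x : 'rV[int]_d) (rho T : R) : Prop :=
  forall u : nat -> 'rV[int]_d -> R,
    (forall n y, n%:R <= T -> vclosure G (gball G x rho) y -> 0 <= u n y) ->
    caloric G mu x rho T u ->
    let uhat n y := u n.+1 y + u n y in
    let Qminus := [set n : nat | T / 4 <= n%:R <= T / 2 /\ n.+1%:R <= T] in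
    let Qplus := [set n : nat | 3 * T / 4 <= n%:R <= T /\ n.+1%:R <= T] in
    (ereal_sup [set (uhat n y)%:E | n in Qminus & y in gball G x (rho / 2)%R]
     <= CH%:E *
        ereal_inf [set (uhat n y)%:E | n in Qplus & y in gball G x (rho / 2)%R])%E.

(* Main.v *)
Require Import Defs.
From mathcomp Require Import all_boot all_order all_algebra.
From mathcomp Require Import finmap.
From mathcomp Require Import all_classical all_reals all_analysis measurable_realfun.
From mathcomp Require Import ring lra zify.
Set Implicit Arguments.
Unset Strict Implicit.
Unset Printing Implicit Defensive.
Import Order.TTheory GRing.Theory Num.Theory.
Import numFieldNormedType.Exports.
Local Open Scope classical_set_scope.
Local Open Scope ring_scope.

(* The transition density p_n(x, y) is A^n (delta_x / mu_x) (y), where A is the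
   averaging operator, self-adjoint and contracting in l^2(mu).  Near a rational
   point q the PHI makes k |-> p_k + p_(k+1) nearly constant at scale lam sqrt n,
   so its value at g_n(x) is close to its mu-average over a small cube around q;
   by (a) and (e) that average tends to 2 k_t(q) / a_G.  Finitely many cubes cover
   a bounded region, and (b), (d) control large |x| or large t.

   The PHI bounds w(n) + w(n + 1), not w(n), even when it is applied to a w which
   is already a sum of two consecutive densities, so the oscillation argument only
   closes if p_k - p_(k+2) is small with respect to n^(-d/2).  This comes from
   l^2: the numbers |A^j (1 - A^2) f|^2 are the second differences of the sequence
   |A^j f|^2 and decrease in j, hence are O(|f|^2 / j), while the PHI bounds
   p_k(y, y) for y near g_n(q). *)

(** * Reversible kernels *)

(** Hypothesis (b) only concerns walks started at 0, so the pairing <A^(i+l) (1 - A^2) delta_0, A^b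
    delta_y> splits the time into three pieces of order at least n: the first factor has squared
    norm O(n^(-d/2) / n) by (b), the second one has squared norm p_(2b)(y, y) = O(n^(-d/2)) by the
    PHI, and their product gains a factor n^(-1/2) over n^(-d/2). This gain suffices because the
    oscillation argument runs through a number K of scales that depends on the desired accuracy and
    not on n: every scale costs an additive error, and K of them remain negligible. The thresholds
    in (e) depend on the rational point in an uncontrolled way. Hence every radius at scale sqrt n
    has to be fixed before the rational point; only then does compactness leave finitely many
    thresholds to compare. *)

Section ReversibleKernel.
Context (R : realType) (V : choiceType) (U : set V) (m : V -> V -> R).
Implicit Types (f g h : V -> R) (x y z : V) (L : {fset V}).

Let wt x := \sum_(y \in U) m x y.

Hypothesis m_sym : forall x y, U x -> U y -> m x y = m y x.
Hypothesis m_ge0 : forall x y, U x -> U y -> 0 <= m x y.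
Hypothesis m_fin : forall x, U x -> finite_set [set y | U y /\ m x y != 0].
Hypothesis wt_gt0 : forall x, U x -> 0 < wt x.

Definition finsupp_on f := finite_set [set x | U x /\ f x != 0].

Definition average f x := (wt x)^-1 * \sum_(y \in U) (m x y * f y).

Definition inner f g := \sum_(x \in U) (wt x * f x * g x).

(** Sums over the possibly infinite set [U] have finite support; exchanges and comparisons of sums
    are made on one list that contains every support involved. *)
Lemma fsum_list f L : [set` L] `<=` U ->
  (forall x, U x -> x \notin L -> f x = 0) ->
  \sum_(x \in U) f x = \sum_(x <- L) f x.
Proof.
move=> LU L0; rewrite [RHS]fsbig_seq//; apply/esym/fsbig_widen => //.
by move=> x [Ux /negP]; exact: L0.
Qed.

Lemma finsupp_list f : finsupp_on f ->
  exists2 L : {fset V}, [set` L] `<=` U & forall x, U x -> x \notin L -> f x = 0.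
Proof.
move=> ff; exists (fset_set [set x | U x /\ f x != 0]).
  by move=> x /=; rewrite in_fset_set// inE => -[].
move=> x Ux; rewrite in_fset_set// notin_setE /= => H.
by apply/eqP; apply: contrapT => /negP H'; apply: H.
Qed.

Lemma finsupp_list2 f g : finsupp_on f -> finsupp_on g ->
  exists L : {fset V}, [/\ [set` L] `<=` U,
    forall x, U x -> x \notin L -> f x = 0 &
    forall x, U x -> x \notin L -> g x = 0].
Proof.
move=> /finsupp_list[L1 U1 H1] /finsupp_list[L2 U2 H2].
exists (L1 `|` L2)%fset; split.
- by move=> x /=; rewrite inE => /orP[/U1|/U2].
- by move=> x Ux; rewrite inE negb_or => /andP[/(H1 _ Ux)].
- by move=> x Ux; rewrite inE negb_or => /andP[_ /(H2 _ Ux)].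
Qed.

Lemma finsupp_lin f g (a b : R) : finsupp_on f -> finsupp_on g ->
  finsupp_on (fun x => a * f x + b * g x).
Proof.
move=> ff gf.
apply: (@sub_finite_set _ _
  ([set x | U x /\ f x != 0] `|` [set x | U x /\ g x != 0])).
  move=> x [Ux /=]; have [f0|f0 _] := eqVneq (f x) 0; last by left.
  have [g0|g0 _] := eqVneq (g x) 0; last by right.
  by rewrite f0 g0 !mulr0 addr0 eqxx.
by rewrite finite_setU.
Qed.

Lemma finsupp_average f : finsupp_on f -> finsupp_on (average f).
Proof.
move=> ff.
apply: (@sub_finite_set _ _ (\bigcup_(y in [set y | U y /\ f y != 0])
    [set x | U x /\ m y x != 0])).
  move=> x [Ux]; apply: contra_neqP => H.
  rewrite /average fsbig1 ?mulr0// => y Uy.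
  apply/eqP; apply: contrapT => /negP; rewrite mulf_eq0 negb_or => /andP[m0 f0].
  by apply: H; exists y => //; split=> //; rewrite m_sym.
by apply: bigcup_finite => // y [Uy _]; exact: m_fin.
Qed.

Lemma innerC f g : inner f g = inner g f.
Proof. by apply: eq_fsbigr => x _; rewrite mulrAC. Qed.

Lemma inner_lin f g h (a b : R) :
  finsupp_on f -> finsupp_on g -> finsupp_on h ->
  inner (fun x => a * f x + b * g x) h = a * inner f h + b * inner g h.
Proof.
move=> ff gf hf; have [L [LU f0 h0]] := finsupp_list2 ff hf.
rewrite /inner !(@fsum_list _ L)//; try
  by move=> x Ux xL; rewrite h0// mulr0.
rewrite !mulr_sumr -big_split/=; apply: eq_bigr => x _.
by rewrite !mulrDr mulrDl; congr (_ + _); ring.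
Qed.

Lemma inner_ge0 f : 0 <= inner f f.
Proof.
apply: fsumr_ge0 => x Ux.
by rewrite -mulrA mulr_ge0 ?(ltW (wt_gt0 _))//; exact: sqr_ge0.
Qed.

Lemma inner_average_sum f g L : [set` L] `<=` U ->
  (forall x, U x -> x \notin L -> f x = 0) ->
  (forall x, U x -> x \notin L -> g x = 0) ->
  inner (average f) g = \sum_(x <- L) \sum_(y <- L) m x y * f y * g x.
Proof.
move=> LU f0 g0.
rewrite /inner (@fsum_list _ L)//; last by move=> x Ux xL; rewrite g0 ?mulr0.
rewrite big_seq_cond [RHS]big_seq_cond; apply: eq_bigr => x /andP[/LU Ux _].
rewrite /average mulrA divff ?gt_eqF ?wt_gt0// mul1r.
rewrite (@fsum_list _ L)//; last by move=> y Uy yL; rewrite f0 ?mulr0.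
by rewrite mulr_suml.
Qed.

Lemma inner_average f g : finsupp_on f -> finsupp_on g ->
  inner (average f) g = inner f (average g).
Proof.
move=> ff gf; have [L [LU f0 g0]] := finsupp_list2 ff gf.
rewrite [RHS]innerC !(@inner_average_sum _ _ L)// exchange_big/=.
rewrite big_seq_cond [RHS]big_seq_cond; apply: eq_bigr => x /andP[/LU Ux _].
rewrite big_seq_cond [RHS]big_seq_cond; apply: eq_bigr => y /andP[/LU Uy _].
by rewrite (m_sym Ux Uy) mulrAC.
Qed.

Lemma sum_le_wt L x : [set` L] `<=` U -> U x -> \sum_(y <- L) m x y <= wt x.
Proof.
move=> LU Ux; pose M := (L `|` fset_set [set y | U y /\ m x y != 0])%fset.
have MU : [set` M] `<=` U.
  move=> y /=; rewrite inE => /orP[/LU//|].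
  by rewrite in_fset_set ?inE; [case | exact: m_fin].
rewrite /wt (@fsum_list _ M)//; last first.
  move=> y Uy; rewrite inE negb_or in_fset_set; last exact: m_fin.
  move=> /andP[_]; rewrite notin_setE /= => H.
  by apply/eqP; apply: contrapT => /negP H'; apply: H.
rewrite [leRHS](big_fsetID _ [pred y | y \in L])/=.
rewrite (_ : [fset y in M | y \in L]%fset = L); last first.
  by apply/fsetP => y; rewrite !inE/=; case: (y \in L); rewrite ?andbF.
rewrite lerDl big_seq_cond; apply: sumr_ge0 => y /andP[+ _].
by rewrite in_fset/= inE => /andP[yM _]; apply: m_ge0 => //; exact: (MU y).
Qed.

(* [2 a b <= a ^+ 2 + b ^+ 2] under the symmetric double sum gives
   [|Af|^2 <= (|f|^2 + |Af|^2) / 2]. *)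
Lemma average_contraction f : finsupp_on f ->
  inner (average f) (average f) <= inner f f.
Proof.
move=> ff; have af := finsupp_average ff.
have [L [LU f0 a0]] := finsupp_list2 ff af.
have sumL g : (forall x, U x -> x \notin L -> g x = 0) ->
    \sum_(x <- L) \sum_(y <- L) m x y * g x ^+ 2 <= inner g g.
  move=> g0; rewrite /inner (@fsum_list _ L)//; last first.
    by move=> x Ux xL; rewrite g0 ?mulr0.
  rewrite big_seq_cond [leRHS]big_seq_cond; apply: ler_sum => x /andP[/LU Ux _].
  rewrite -mulr_suml -mulrA -expr2; apply: ler_wpM2r; first exact: sqr_ge0.
  exact: sum_le_wt.
have sumL' g : (forall x, U x -> x \notin L -> g x = 0) ->
    \sum_(x <- L) \sum_(y <- L) m x y * g y ^+ 2 <= inner g g.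
  move=> /sumL; apply: le_trans; rewrite exchange_big/=.
  rewrite big_seq_cond [leRHS]big_seq_cond; apply: ler_sum => x /andP[/LU Ux _].
  rewrite big_seq_cond [leRHS]big_seq_cond; apply: ler_sum => y /andP[/LU Uy _].
  by rewrite m_sym.
suff : 2 * inner (average f) (average f) <=
       inner f f + inner (average f) (average f) by lra.
apply: le_trans (lerD (sumL' _ f0) (sumL _ a0)).
rewrite (@inner_average_sum _ _ L)// mulr_sumr -big_split/=.
rewrite big_seq_cond [leRHS]big_seq_cond; apply: ler_sum => x /andP[/LU Ux _].
rewrite mulr_sumr -big_split/=.
rewrite big_seq_cond [leRHS]big_seq_cond; apply: ler_sum => y /andP[/LU Uy _].
rewrite -mulrDr -mulrA mulrCA; apply: ler_wpM2l; first exact: m_ge0.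
have := sqr_ge0 (f y - average f x); rewrite !expr2; nra.
Qed.

(** Expand [|c f - t g|^2 >= 0] with [t] equal to 1 or -1 and divide by [c]. The free [c] serves to
    balance two norms of different size; it becomes [sq n]. *)
Lemma inner_amgm f g (c : R) : 0 < c -> finsupp_on f -> finsupp_on g ->
  2 * `|inner f g| <= c * inner f f + c^-1 * inner g g.
Proof.
move=> c0 ff gf.
have H (t : R) : t ^+ 2 = 1 -> 2 * (t * inner f g) <= c * inner f f + c^-1 * inner g g.
  move=> t1; have lf := finsupp_lin c (- t) ff gf.
  have := inner_ge0 (fun x => c * f x + (- t) * g x).
  rewrite inner_lin// (innerC f) (innerC g) !inner_lin// (innerC g f) => Q.
  have ci : 0 < c^-1 by rewrite invr_gt0.
  have cc : c^-1 * c = 1 by rewrite mulVf ?gt_eqF.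
  have Q2 : 0 <= c^-1 * (c * (c * inner f f + - t * inner f g) +
                - t * (c * inner f g + - t * inner g g)).
    by rewrite mulr_ge0// ltW.
  have : c^-1 * (c * (c * inner f f + - t * inner f g) +
                - t * (c * inner f g + - t * inner g g)) =
    (c^-1 * c) * (c * inner f f - 2 * (t * inner f g)) +
    c^-1 * (t ^+ 2 * inner g g) by ring.
  by rewrite cc t1 !mul1r => E; move: Q2; rewrite E; lra.
case: ger0P => _; first by have := H 1 (expr1n _ _); rewrite mul1r.
by have := H (-1); rewrite sqrrN expr1n mulN1r => /(_ erefl).
Qed.

Definition point_density x y := if y == x then (wt x)^-1 else 0.

Definition tdensity n x : V -> R := iter n average (point_density x).

Lemma finsupp_tdensity n x : finsupp_on (tdensity n x).
Proof.
elim: n => [|n IH] /=; last exact: finsupp_average.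
apply: (@sub_finite_set _ _ [set x]); last exact: finite_set1.
move=> y [_]; rewrite /tdensity/= /point_density /set1/=.
by case: (y =P x) => // _; rewrite eqxx.
Qed.

Lemma inner_point f x : U x -> inner f (point_density x) = f x.
Proof.
move=> Ux; rewrite /inner (@fsum_list _ [fset x]%fset).
- rewrite big_seq_fset1 /point_density eqxx mulrAC mulfV ?mul1r//.
  by rewrite gt_eqF ?wt_gt0.
- by move=> y /=; rewrite inE => /eqP ->.
- by move=> y Uy; rewrite inE /point_density => /negbTE ->; rewrite mulr0.
Qed.

Lemma tdensityS n x y : tdensity n.+1 x y = average (tdensity n x) y.
Proof. by []. Qed.

(** Self-adjointness moves the averaging operators to the first argument one by one, and pairing
    with [point_density] evaluates at [y]. This is Chapman-Kolmogorov in symmetric form. *)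
Lemma inner_tdensity a b x y : U y ->
  inner (tdensity a x) (tdensity b y) = tdensity (a + b) x y.
Proof.
move=> Uy; elim: b a => [|b IH] a; first by rewrite addn0 inner_point.
rewrite addnS -addSn -IH [RHS]inner_average//; exact: finsupp_tdensity.
Qed.

Lemma tdensity_ge0 n x y : U x -> U y -> 0 <= tdensity n x y.
Proof.
move=> Ux; elim: n y => [|n IH] y Uy.
  rewrite /tdensity/= /point_density; case: ifP => // _.
  by rewrite invr_ge0 ltW ?wt_gt0.
rewrite tdensityS mulr_ge0 ?invr_ge0 ?(ltW (wt_gt0 _))//.
by apply: fsumr_ge0 => z Uz; rewrite mulr_ge0 ?m_ge0 ?IH.
Qed.

(** The function A^i (1 - A^2) applied to the point density; the coefficients 1 and -1 are kept
    explicit so that [inner_lin] and [finsupp_lin] apply. *)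
Let lag2 i x y := 1 * tdensity i x y + (-1) * tdensity i.+2 x y.

Lemma finsupp_lag2 i x : finsupp_on (lag2 i x).
Proof. by apply: finsupp_lin; exact: finsupp_tdensity. Qed.

Lemma inner_lag2 i x : U x ->
  inner (lag2 i x) (lag2 i x) =
  tdensity i.*2 x x - 2 * tdensity i.+1.*2 x x + tdensity i.+2.*2 x x.
Proof.
move=> Ux.
have fk j : finsupp_on (tdensity j x) := finsupp_tdensity j x.
have fl := finsupp_lag2 i x.
rewrite {1}/lag2 inner_lin// (innerC (tdensity i x)) (innerC (tdensity i.+2 x)).
rewrite /lag2 !inner_lin// !inner_tdensity// addSn addnS !addSn !addnS addnn.
by rewrite !doubleS; ring.
Qed.

Lemma average_lag2 i x y : average (lag2 i x) y = lag2 i.+1 x y.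
Proof.
have [L LU f0] := finsupp_list (finsupp_tdensity i x).
have [L' LU' f0'] := finsupp_list (finsupp_tdensity i.+2 x).
pose M := (L `|` L')%fset.
have MU : [set` M] `<=` U by move=> z /=; rewrite inE => /orP[/LU|/LU'].
have k0 z : U z -> z \notin M -> tdensity i x z = 0.
  by move=> Uz; rewrite inE negb_or => /andP[/(f0 _ Uz)].
have k2 z : U z -> z \notin M -> tdensity i.+2 x z = 0.
  by move=> Uz; rewrite inE negb_or => /andP[_ /(f0' _ Uz)].
rewrite /lag2 !tdensityS /average !(@fsum_list _ M)//; try
  by move=> z Uz zM; rewrite ?k0 ?k2 ?(mulr0, addr0).
rewrite mul1r mulN1r -mulrBr -sumrB; congr (_ * _); apply: eq_bigr => z _.
by rewrite mul1r mulN1r mulrBr.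
Qed.

Lemma inner_lag2_nincr i j x :
  inner (lag2 (i + j) x) (lag2 (i + j) x) <= inner (lag2 i x) (lag2 i x).
Proof.
elim: j => [|j IH]; first by rewrite addn0.
rewrite addnS; apply: le_trans IH.
rewrite -[leLHS](_ : inner (average (lag2 (i + j) x)) (average (lag2 (i + j) x)) = _).
  exact/average_contraction/finsupp_lag2.
by apply: eq_fsbigr => z _; rewrite average_lag2.
Qed.

Lemma inner_lag2_le i l x : U x ->
  l.+1%:R * inner (lag2 (i + l) x) (lag2 (i + l) x) <=
  tdensity i.*2 x x + tdensity (i + l).+2.*2 x x.
Proof.
move=> Ux; pose D j := tdensity j.*2 x x - tdensity j.+1.*2 x x.
have tele k : \sum_(j < k) inner (lag2 (i + j) x) (lag2 (i + j) x) =
    D i - D (i + k)%N.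
  elim: k => [|k IH]; first by rewrite big_ord0 addn0 subrr.
  by rewrite big_ord_recr/= IH inner_lag2// /D addnS; ring.
apply: (@le_trans _ _ (D i - D (i + l.+1)%N)).
  rewrite -tele mulr_natl -{1}[l.+1]card_ord -sumr_const.
  apply: ler_sum => j _; have jl : (j <= l)%N by rewrite -ltnS.
  by have := inner_lag2_nincr (i + j) (l - j) x; rewrite -addnA subnKC.
(* The two densities that occur with a minus sign in [D i - D (i + l.+1)] are nonnegative and are
   dropped. *)
have k1 := tdensity_ge0 i.+1.*2 Ux Ux.
have k2 := tdensity_ge0 (i + l).+1.*2 Ux Ux.
by rewrite /D addnS; lra.
Qed.

(* The squared norms [e_j = |A^j (1 - A^2) delta|^2] are the second differences
   of [p_(2j)(x, x)] and decrease in [j], so averaging a telescoping sum gives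
   [e_j = O(p / j)]: this is the smoothness in time which rules out
   parity oscillations. *)
Lemma tdensity_time_regularity i l b (c : R) x y : 0 < c -> U x -> U y ->
  2 * `|tdensity (i + l + b) x y - tdensity (i + l + b).+2 x y| <=
  c * ((tdensity i.*2 x x + tdensity (i + l).+2.*2 x x) / l.+1%:R) +
  c^-1 * tdensity b.*2 y y.
Proof.
move=> c0 Ux Uy.
have -> : tdensity (i + l + b) x y - tdensity (i + l + b).+2 x y =
    inner (lag2 (i + l) x) (tdensity b y).
  rewrite inner_lin; try exact: finsupp_tdensity.
  by rewrite !inner_tdensity// !addSn; ring.
apply: le_trans (inner_amgm c0 (finsupp_lag2 _ _) (finsupp_tdensity _ _)) _.
rewrite inner_tdensity// addnn lerD2r; apply: ler_wpM2l; first exact: ltW.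
by rewrite ler_pdivlMr ?ltr0Sn// mulrC inner_lag2_le.
Qed.

End ReversibleKernel.

(** * Lattice graphs and their Markov chains *)

Lemma finite_int_box (d N : nat) :
  finite_set [set z : 'rV[int]_d | forall i, `|z 0 i| <= N%:Z].
Proof.
pose g (f : {ffun 'I_d -> 'I_(N.*2.+1)}) : 'rV[int]_d :=
  \row_i ((f i)%:Z - N%:Z).
apply: (@sub_finite_set _ _ (g @` setT)).
  move=> z /= zN.
  have zN' i : (0 <= z 0 i + N%:Z <= N.*2%:Z)%R.
    by have := zN i; lia.
  exists [ffun i => inord (absz (z 0 i + N%:Z))] => //.
  apply/rowP => i; rewrite /g mxE ffunE inordK.
    by have := zN' i; lia.
  by have := zN' i; lia.
exact/finite_image/finite_finset.
Qed.

Section Conductances.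
Context (R : realType) (d : nat) (G : lattice_graph d) (CM : R)
  (mu : 'rV[int]_d -> 'rV[int]_d -> R).
Hypothesis cond : conductances G CM mu.
Hypothesis G_inf : infinite_set (vset G).
Hypothesis G_conn : graph_connected G.
Implicit Types x y z : 'rV[int]_d.

Lemma edge_vset_r x y : edge G x y -> vset G y.
Proof. by rewrite edge_sym; exact: edge_vset. Qed.

Lemma edge_coord x y i : edge G x y -> `|x 0 i - y 0 i| <= 1.
Proof.
move=> /edge_nn <-; rewrite (bigD1 i)//= lerDl.
by apply: sumr_ge0 => j _; exact: normr_ge0.
Qed.

Lemma cond_ge0 x y : vset G x -> vset G y -> 0 <= mu x y.
Proof.
move=> Ux Uy; have [<-|xy] := eqVneq x y; first by case/andP: (cond_diag cond Ux).
have [e|e] := boolP (edge G x y); last by rewrite (cond_zero cond).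
case/andP: (cond_edge cond e) => + _; apply: le_trans.
by rewrite invr_ge0 ltW ?(cond_CM cond).
Qed.

Lemma cond_fin x : vset G x -> finite_set [set y | vset G y /\ mu x y != 0].
Proof.
move=> Ux; pose N := (\sum_i absz (x 0%R i)).+1%N.
apply: sub_finite_set (finite_int_box d N) => y [Uy muxy] i /=.
have xi : `|x 0 i| <= (\sum_i absz (x 0%R i))%N%:Z :> int.
  by rewrite -abszE lez_nat (bigD1 i)//= leq_addr.
have /orP[/eqP xy|e] : (x == y) || edge G x y.
  apply: contraNT muxy; rewrite negb_or => /andP[xy e].
  by rewrite (cond_zero cond).
  by rewrite -xy (le_trans xi)// lez_nat leqnSn.
have := edge_coord i e; move: xi; rewrite /N; set S := (\sum_i _)%N.
by move: (x 0 i) (y 0 i) S => a b S; lia.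
Qed.

(** An isolated vertex could have weight 0, since [mu x x = 0] is allowed. In an infinite connected
    graph a walk to another vertex starts with an edge. *)
Lemma exists_neighbour x : vset G x -> exists y, edge G x y.
Proof.
move=> Ux; have [y [Uy xy]] : exists y, vset G y /\ x != y.
  apply: contrapT => H; apply: G_inf; apply: (@sub_finite_set _ _ [set x]).
    move=> y Uy /=; apply: contrapT => yx; apply: H; exists y; split=> //.
    by apply/eqP => xy; apply: yx.
  exact: finite_set1.
have [n [[|z p] [/= pth lst _]]] := G_conn Ux Uy.
  by rewrite lst eqxx in xy.
by case/andP: pth => e _; exists z.
Qed.

Lemma vweight_gt0 x : vset G x -> 0 < vweight G mu x.
Proof.
move=> Ux; have [y e] := exists_neighbour Ux.
have Uy := edge_vset_r e.
apply: (@lt_le_trans _ _ (mu x y)).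
  case/andP: (cond_edge cond e) => + _; apply: lt_le_trans.
  by rewrite invr_gt0 (cond_CM cond).
have -> : mu x y = \sum_(z <- [fset y]%fset) mu x z by rewrite big_seq_fset1.
apply: (@sum_le_wt _ _ (vset G) mu cond_ge0 cond_fin) => //.
by move=> z /=; rewrite inE => /eqP ->.
Qed.

End Conductances.

(** * Law of the chain as iterates of the averaging operator *)

Section MarkovKernel.
Context (R : realType) (d : nat) (G : lattice_graph d)
  (mu : 'rV[int]_d -> 'rV[int]_d -> R)
  (disp : measure_display) (Omega : measurableType disp)
  (P : 'rV[int]_d -> probability Omega R) (X : nat -> Omega -> 'rV[int]_d).
Hypothesis chain : markov_chain G mu P X.
Implicit Types (x y : 'rV[int]_d) (z : nat -> 'rV[int]_d).

Let path_event j n z := [set w | forall i, (j <= i <= n)%N -> X i w = z i].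

Lemma measurable_path_event j n z : measurable (path_event j n z).
Proof.
rewrite [path_event _ _ _](_ : _ =
    \bigcap_(i in [set i | (j <= i <= n)%N]) [set w | X i w = z i]).
  by apply: bigcap_measurableType => i _; exact: chain_meas chain _ _.
by apply/seteqP; split => w.
Qed.

Lemma total_probability x j (A : set Omega) : measurable A ->
  P x A = (\sum_(k <oo) P x (A `&` [set w | choice.pickle (X j w) = k]))%E.
Proof.
move=> mA.
have mX k : measurable [set w | choice.pickle (X j w) = k].
  have [[v <-]|H] := pselect (exists v : 'rV[int]_d, choice.pickle v = k).
    rewrite [X in measurable X](_ : _ = [set w | X j w = v]).
      exact: chain_meas chain _ _.
    apply/seteqP; split => w /= => [|->//].
    by move/(pcan_inj choice.pickleK).
  rewrite [X in measurable X](_ : _ = set0)//.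
  by apply/seteqP; split => w //= E; apply: H; exists (X j w).
rewrite -measure_semi_bigcup.
- congr (P x _); apply/seteqP; split => [w Aw|w [k _ []]//].
  by exists (choice.pickle (X j w)).
- by move=> k; exact: measurableI.
- by move=> k l _ _ [w [[_ /= <-] [_ /= <-]]].
- by apply: bigcup_measurable => k _; exact: measurableI.
Qed.

(** [chain_step] conditions on the whole past from time 0. Summing out the earliest coordinate
    removes it from the past, one time after another; [j = n] is the Markov property. *)
Lemma path_event_step x j n z : vset G x -> (forall i, vset G (z i)) ->
  (j <= n)%N ->
  P x (path_event j n.+1 z) =
  (P x (path_event j n z) * (mu (z n) (z n.+1) / vweight G mu (z n))%:E)%E.
Proof.
move=> Ux; elim: j z => [|j IH] z Uz jn; first exact: chain_step chain _ _ _ _ _.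
have := total_probability x j (measurable_path_event j.+1 n z).
have := total_probability x j (measurable_path_event j.+1 n.+1 z).
move=> -> ->; rewrite muleC -nneseriesZl//.
apply: eq_eseriesr => k _; rewrite muleC.
(* A code that belongs to no vertex of [G] contributes nothing, as the chain stays in [G]. *)
have [H|H] := pselect (exists2 v, vset G v & choice.pickle v = k); last first.
  have E0 m : path_event j.+1 m z `&` [set w | choice.pickle (X j w) = k] = set0.
    apply/seteqP; split => // w [_ /= Xk]; apply: H.
    by exists (X j w) => //; exact: chain_state chain _ _.
  by rewrite !E0 !measure0 mul0e.
(* [z'] prescribes the value [v] at time [j], which turns a slice of the event starting at [j.+1]
   into an event starting at [j]. *)
case: H => v Uv <-; pose z' i := if i == j then v else z i.
have Uz' i : vset G (z' i) by rewrite /z'; case: ifP.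
have E m : (j < m)%N -> path_event j.+1 m z `&` [set w | choice.pickle (X j w) = choice.pickle v]
    = path_event j m z'.
  move=> jm; apply/seteqP; split => w.
    move=> [H /= /(pcan_inj choice.pickleK) Xj] i /andP[ji im]; rewrite /z'.
    have [->//|ij] := eqVneq i j; apply: H.
    by rewrite im andbT ltn_neqAle eq_sym ij.
  move=> H; split.
    move=> i /andP[ji im]; rewrite H ?(ltnW ji)// /z'.
    by rewrite gtn_eqF.
  by rewrite /= H ?leqnn ?(ltnW jm)// /z' eqxx.
rewrite !E ?(leq_trans jn)// IH// ?(ltnW jn)//.
by rewrite /z' !gtn_eqF// ltnS ltnW.
Qed.

Lemma chain_joint x n y y' : vset G x -> vset G y -> vset G y' ->
  P x [set w | X n w = y /\ X n.+1 w = y'] =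
  (P x [set w | X n w = y] * (mu y y' / vweight G mu y)%:E)%E.
Proof.
move=> Ux Uy Uy'; pose z i := if i == n then y else y'.
have Uz i : vset G (z i) by rewrite /z; case: ifP.
have zn : z n = y by rewrite /z eqxx.
have zn1 : z n.+1 = y' by rewrite /z gtn_eqF.
have := path_event_step Ux Uz (leqnn n); rewrite zn zn1.
have -> : path_event n n z = [set w | X n w = y].
  apply/seteqP; split => w /=; first by move/(_ n); rewrite leqnn zn; exact.
  by move=> Xn i /=; rewrite -eqn_leq => /eqP <-; rewrite zn.
move=> <-.
congr (P x _); apply/seteqP; split => w /=.
  move=> [Xn Xn1] i /andP[ni]; rewrite leq_eqVlt => /orP[/eqP ->|].
    by rewrite zn1.
  rewrite ltnS => i_n; have -> : i = n by apply/eqP; rewrite eqn_leq i_n.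
  by rewrite zn.
move=> H; split; first by rewrite H ?leqnn ?leqnSn// zn.
by rewrite H ?leqnn ?leqnSn// zn1.
Qed.

Lemma measurable_state_fset n (L : {fset 'rV[int]_d}) :
  measurable [set w | X n w \in L].
Proof.
rewrite [X in measurable X](_ : _ = \bigcup_(y in [set` L]) [set w | X n w = y]).
  apply: fin_bigcup_measurable => // y _; exact: chain_meas chain _ _.
apply/seteqP; split => w /=; first by move=> XL; exists (X n w).
by move=> [y /= yL ->].
Qed.

Lemma prob_fset x n (L : {fset 'rV[int]_d}) (A : set Omega) : measurable A ->
  fine (P x (A `&` [set w | X n w \in L])) =
  \sum_(y <- L) fine (P x (A `&` [set w | X n w = y])).
Proof.
move=> mA.
have mB y : measurable (A `&` [set w | X n w = y]).
  by apply: measurableI => //; exact: chain_meas chain _ _.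
rewrite [X in P x X](_ : _ =
    \bigcup_(y in [set` L]) (A `&` [set w | X n w = y])).
  rewrite measure_fin_bigcup//; last by move=> y y' _ _ [w [[_ /= <-] [_ /= <-]]].
  rewrite -fsbig_seq// [RHS]sum_fine// => y _.
  exact: fin_num_measure.
apply/seteqP; split => w; first by move=> [Aw /= Xw]; exists (X n w).
by move=> [y /= yL [Aw Xw]]; split => //=; rewrite Xw.
Qed.

Lemma prob_fset_le1 x n (L : {fset 'rV[int]_d}) :
  \sum_(y <- L) fine (P x [set w | X n w = y]) <= 1.
Proof.
have := @prob_fset x n L setT measurableT.
under eq_bigr do rewrite setTI; move=> <-.
have mL := measurable_state_fset n L.
by rewrite -lee_fin setTI fineK ?fin_num_measure// probability_le1.
Qed.

Context (CM : R).
Hypothesis cond : conductances G CM mu.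
Hypothesis G_inf : infinite_set (vset G).
Hypothesis G_conn : graph_connected G.

(** Decomposing at the penultimate state [z] gives the sum of [P(X_n = z) mu_zy / mu_z]. Passing to
    densities cancels [mu_z], and [mu_zy = mu_yz] turns the sum into [mu_y] times the average at
    [y]. *)
Lemma prob_tdensity x n y : vset G x -> vset G y ->
  fine (P x [set w | X n w = y]) = vweight G mu y * tdensity (vset G) mu n x y.
Proof.
move=> Ux; elim: n y => [|n IH] y Uy.
  have mX v : measurable [set w | X 0%N w = v] by exact: chain_meas chain _ _.
  have [->|yx] := eqVneq y x.
    rewrite (chain_init chain Ux)/= /tdensity/= /point_density eqxx mulfV//.
    by rewrite gt_eqF// (vweight_gt0 cond).
  rewrite /tdensity/= /point_density (negbTE yx) mulr0.
  suff -> : P x [set w | X 0%N w = y] = 0%E by [].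
  apply/eqP; rewrite eq_le measure_ge0 andbT.
  apply: (@le_trans _ _ (P x (~` [set w | X 0%N w = x]))).
    apply: le_measure; rewrite ?inE//; first exact: measurableC.
    by move=> w /= -> /eqP; exact/negP.
  by rewrite probability_setC// (chain_init chain Ux) subee.
have [L LU k0] := finsupp_list (finsupp_tdensity (cond_sym cond) (cond_fin cond) n x).
set A := [set w | X n.+1 w = y].
have mA : measurable A by exact: chain_meas chain _ _.
have mL := measurable_state_fset n L.
(* By the induction hypothesis each state outside [L] has probability 0; there are countably many,
   so the decomposition reduces to the list [L]. *)
have PL0 : P x (~` [set w | X n w \in L]) = 0%E.
  rewrite (@total_probability x n)//; last exact: measurableC.
  apply: eseries0 => k _ _.
  have [[v <-]|H] := pselect (exists v : 'rV[int]_d, choice.pickle v = k); last first.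
    rewrite [X in P x X](_ : _ = set0) ?measure0//.
    by apply/seteqP; split => // w [_ /= Xk]; apply: H; exists (X n w).
  have [vL|vL] := boolP (v \in L).
    rewrite [X in P x X](_ : _ = set0) ?measure0//.
    by apply/seteqP; split => // w [/= + /(pcan_inj choice.pickleK) E]; rewrite E.
  have mv : measurable [set w | X n w = v] by exact: chain_meas chain _ _.
  apply/eqP; rewrite eq_le measure_ge0 andbT.
  apply: (@le_trans _ _ (P x [set w | X n w = v])).
    apply: le_measure; rewrite ?inE//.
      rewrite [X in measurable X](_ : _ =
        ~` [set w | X n w \in L] `&` [set w | X n w = v]).
        by apply: measurableI => //; exact: measurableC.
      apply/seteqP; split => w /= [? E]; split=> //; last by rewrite E.
      exact: (pcan_inj choice.pickleK).
    by move=> w [_ /= /(pcan_inj choice.pickleK)].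
  have [Uv|Uv] := pselect (vset G v).
    by rewrite -[leLHS]fineK ?fin_num_measure// IH// k0 ?mulr0.
  rewrite [X in P x X](_ : _ = set0) ?measure0//.
  by apply/seteqP; split => // w /= E; apply: Uv; rewrite -E; exact: chain_state chain _ _.
have -> : P x A = P x (A `&` [set w | X n w \in L]).
  rewrite -[in LHS](setIT A) -(setUv [set w | X n w \in L]) setIUr measureU.
  - rewrite [X in (_ + X)%E](_ : _ = 0%E) ?adde0//.
    apply/eqP; rewrite eq_le measure_ge0 andbT -PL0.
    by apply: le_measure; rewrite ?inE//; [exact/measurableI/measurableC|
      exact: measurableC].
  - exact: measurableI.
  - exact/measurableI/measurableC.
  - by rewrite setIACA setICr setI0.
rewrite prob_fset// tdensityS /average mulrA mulfV; last first.
  by rewrite gt_eqF// (vweight_gt0 cond).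
rewrite mul1r (@fsum_list _ _ _ _ L)//; last first.
  by move=> z Uz zL; rewrite k0 ?mulr0.
rewrite big_seq_cond [RHS]big_seq_cond; apply: eq_bigr => z /andP[/LU Uz _].
rewrite setIC (_ : _ `&` _ = [set w | X n w = z /\ X n.+1 w = y])//.
rewrite chain_joint// fineM ?fin_num_measure//=; last exact: chain_meas chain _ _.
rewrite IH// (cond_sym cond Uy Uz).
have w0 : vweight G mu z != 0 by rewrite gt_eqF// (vweight_gt0 cond).
by field.
Qed.

Lemma heat_kernelE x n y : vset G x -> vset G y ->
  heat_kernel G mu P X n x y = tdensity (vset G) mu n x y.
Proof.
move=> Ux Uy; rewrite /heat_kernel prob_tdensity// mulrAC mulfV ?mul1r//.
by rewrite gt_eqF// (vweight_gt0 cond).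
Qed.

End MarkovKernel.

(** * Consequences of the parabolic Harnack inequality *)

Lemma row_norm_le (R : realType) d (x : 'rV[R]_d) (r : R) :
  0 <= r -> (forall i, `|x 0 i| <= r) -> `|x| <= r.
Proof.
move=> r0 xr; rewrite [leLHS]/Num.Def.normr/= mx_normrE.
by apply/bigmax_leP; split=> // -[a i] _ /=; rewrite (ord1 a).
Qed.

Lemma row_coord_le (R : realType) d (x : 'rV[R]_d) i : `|x 0 i| <= `|x|.
Proof.
rewrite [leRHS]/Num.Def.normr/= mx_normrE.
by apply/bigmax_geP; right => /=; exists (0, i).
Qed.

Section GraphDistance.
Context (R : realType) (d : nat) (G : lattice_graph d).
Hypothesis G_conn : graph_connected G.
Implicit Types x y z : 'rV[int]_d.

Lemma gdist_le x y n : walk_of_length G x y n -> (gdist G x y <= n)%N.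
Proof.
move=> xyn; rewrite /gdist; case: pselect => // h; case: ex_minnP => k _ kmin.
by apply: kmin; exact/asboolP.
Qed.

Lemma gdist_walk x y : vset G x -> vset G y ->
  walk_of_length G x y (gdist G x y).
Proof.
move=> Ux Uy; rewrite /gdist; case: pselect => [h|].
  by case: ex_minnP => k /asboolP.
by case: (G_conn Ux Uy) => n xyn; case; exists n; exact/asboolP.
Qed.

Lemma gdistxx x : gdist G x x = 0%N.
Proof. by apply/eqP; rewrite -leqn0; apply: gdist_le; exists [::]. Qed.

Lemma gdist_edge x y z : vset G x -> vset G y -> edge G y z ->
  (gdist G x z <= (gdist G x y).+1)%N.
Proof.
move=> Ux Uy yz; have [p [pth lst sz]] := gdist_walk Ux Uy.
apply: gdist_le; exists (rcons p z); split.
- by rewrite rcons_path pth lst.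
- by rewrite last_rcons.
- by rewrite size_rcons sz.
Qed.

Lemma walk_coord x y n i : walk_of_length G x y n ->
  `|x 0 i - y 0 i| <= n%:Z.
Proof.
case=> p [pth <- <-]; elim: p x pth => [|z p IH] x /=.
  by move=> _; rewrite subrr normr0.
case/andP => xz /IH H; have := edge_coord i xz.
move: H; move: (x 0 i) (z 0 i) (last z p 0 i) (size p) => a b c k; lia.
Qed.

Lemma norm_emb_le_gdist x y : vset G x -> vset G y ->
  `|emb R x - emb R y| <= (gdist G x y)%:R.
Proof.
move=> Ux Uy; apply: row_norm_le => // i; rewrite !mxE -intrB -intr_norm -[leRHS]mulrz_nat ler_int.
by rewrite natz; exact/walk_coord/gdist_walk.
Qed.

(** A boundary vertex is one edge further away, hence the radius [r + 1]. *)
Lemma vclosure_gball x y (r : R) : vset G x ->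
  vclosure G (gball G x r) y -> vset G y /\ (gdist G x y)%:R < r + 1.
Proof.
move=> Ux [[Uy xy]|[Uy _ [z [Uz xz] yz]]]; split=> //.
  by rewrite (lt_trans xy)// ltrDl.
have := gdist_edge Ux Uz (y := z) (z := y); rewrite edge_sym yz => /(_ isT).
rewrite -(ler_nat R) => /le_lt_trans; apply.
by rewrite -natr1 ltrD2r.
Qed.

End GraphDistance.

(** * Caloric functions and one step of oscillation decay *)

Section Harnack.
Context (R : realType) (d : nat) (G : lattice_graph d) (CM : R)
  (mu : 'rV[int]_d -> 'rV[int]_d -> R).
Hypothesis cond : conductances G CM mu.
Hypothesis G_inf : infinite_set (vset G).
Hypothesis G_conn : graph_connected G.
Implicit Types (x y z : 'rV[int]_d) (w : nat -> 'rV[int]_d -> R).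

(** Every function to which the PHI is applied solves the heat equation on the whole graph, so
    cylinders enter only through bounds and positivity. *)
Definition globally_caloric w :=
  forall n y, vset G y -> w n.+1 y - w n y = laplacian G mu (w n) y.

Lemma neighbour_list y : vset G y -> exists2 L : {fset 'rV[int]_d},
  [set` L] `<=` vset G & forall z, vset G z -> z \notin L -> mu y z = 0.
Proof.
move=> Uy; have fin := cond_fin cond Uy.
exists (fset_set [set z | vset G z /\ mu y z != 0]).
  by move=> z /=; rewrite in_fset_set// inE => -[].
move=> z Uz; rewrite in_fset_set// notin_setE /= => H.
by apply/eqP; apply: contrapT => /negP H'; apply: H.
Qed.

Lemma laplacianE f y : vset G y ->
  laplacian G mu f y = average (vset G) mu f y - f y.
Proof.
move=> Uy; have [L LU L0] := neighbour_list Uy.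
have w0 : vweight G mu y != 0 by rewrite gt_eqF// (vweight_gt0 cond).
have wL : vweight G mu y = \sum_(z <- L) mu y z by exact: fsum_list.
rewrite /average -[\sum_(z \in vset G) mu y z]/(vweight G mu y).
rewrite -[X in _ = _ - X](mulKf w0) {3}wL /laplacian.
rewrite !(@fsum_list _ _ _ _ L)//; try
  by move=> z Uz zL; rewrite L0 ?mul0r.
rewrite -mulrBr mulr_suml -sumrB; congr (_ * _).
by apply: eq_bigr => z _; rewrite mulrBr.
Qed.

(** The Laplacian annihilates constants; this serves for [w - a] and [b - w]. *)
Lemma globally_caloric_affine w (a b : R) : globally_caloric w ->
  globally_caloric (fun n y => a * w n y + b).
Proof.
move=> cw n y Uy; transitivity (a * (w n.+1 y - w n y)); first by ring.
rewrite cw// /laplacian.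
have [L LU L0] := neighbour_list Uy.
rewrite !(@fsum_list _ _ _ _ L)//; try
  by move=> z Uz zL; rewrite L0 ?mul0r.
rewrite mulrCA; congr (_ * _); rewrite mulr_sumr; apply: eq_bigr => z _; ring.
Qed.

Lemma globally_caloricD w1 w2 : globally_caloric w1 -> globally_caloric w2 ->
  globally_caloric (fun n y => w1 n y + w2 n y).
Proof.
move=> cw1 cw2 n y Uy.
transitivity ((w1 n.+1 y - w1 n y) + (w2 n.+1 y - w2 n y)); first by ring.
rewrite cw1// cw2// /laplacian.
have [L LU L0] := neighbour_list Uy.
rewrite !(@fsum_list _ _ _ _ L)//; try
  by move=> z Uz zL; rewrite L0 ?mul0r.
rewrite -mulrDr -big_split/=; congr (_ * _); apply: eq_bigr => z _; ring.
Qed.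

Lemma globally_caloric_shift w k : globally_caloric w ->
  globally_caloric (fun n => w (k + n)%N).
Proof. by move=> cw n y Uy; rewrite addnS cw. Qed.

Lemma tdensity_caloric x :
  globally_caloric (fun n => tdensity (vset G) mu n x).
Proof. by move=> n y Uy; rewrite laplacianE. Qed.

Lemma PHI_pointwise (CH CH' : R) x (rho : R) w : 0 < CH -> CH <= CH' ->
  vset G x -> PHI G mu CH x rho (rho ^+ 2) -> globally_caloric w ->
  (forall n y, n%:R <= rho ^+ 2 -> vset G y -> (gdist G x y)%:R < rho + 1 ->
     0 <= w n y) ->
  forall n n' y y', vset G y -> vset G y' ->
    (gdist G x y)%:R < rho / 2 -> (gdist G x y')%:R < rho / 2 ->
    rho ^+ 2 / 4 <= n%:R <= rho ^+ 2 / 2 -> n.+1%:R <= rho ^+ 2 ->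
    3 * rho ^+ 2 / 4 <= n'%:R -> n'.+1%:R <= rho ^+ 2 ->
    w n.+1 y + w n y <= CH' * (w n'.+1 y' + w n' y').
Proof.
move=> CH0 CHle Ux phi cw w0 n n' y y' Uy Uy' xy xy' nT n1T n'T n1'T.
have n'T2 : n'%:R <= rho ^+ 2 by rewrite (le_trans _ n1'T)// ler_nat.
have xy1 : (gdist G x y')%:R < rho + 1.
  have : 0 <= (gdist G x y')%:R :> R by [].
  by move: xy'; lra.
have w0' k z : k%:R <= rho ^+ 2 -> vclosure G (gball G x rho) z -> 0 <= w k z.
  by move=> kT /(vclosure_gball G_conn Ux)[Uz xz]; exact: w0.
have H := phi w w0' (fun k z _ xz => cw k z xz.1).
rewrite -lee_fin; apply: (@le_trans _ _ (CH%:E * (w n'.+1 y' + w n' y')%:E)%E).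
  apply: (le_trans (le_trans _ H)).
    apply: ereal_sup_ubound; exists n; first by rewrite /= nT.
    by exists y.
  apply: lee_wpmul2l; first by rewrite lee_fin ltW.
  apply: ereal_inf_lbound; exists n'; first by rewrite /= n'T n'T2.
  by exists y'.
rewrite -EFinM lee_fin; apply: ler_wpM2r => //.
by rewrite addr_ge0// w0.
Qed.

(* At one point of the lower cylinder one of [w - a], [b - w] is at least half of
   [b - a] in the averaged sense, and the PHI carries this to the upper cylinder;
   the last hypothesis turns the bound on [w m + w m.+1] into one on [w m]. *)
Lemma oscillation_step (CH CH' : R) x (rho : R) w (t0 : nat) (a b eps : R) :
  0 < CH -> CH <= CH' -> vset G x -> PHI G mu CH x rho (rho ^+ 2) ->
  globally_caloric w -> 1 <= rho -> 16 <= rho ^+ 2 -> rho ^+ 2 <= t0%:R ->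
  (forall m y, vset G y -> (gdist G x y)%:R < 2 * rho ->
     `|m%:R - t0%:R| <= rho ^+ 2 -> a <= w m y <= b) ->
  (forall m y, vset G y -> (gdist G x y)%:R < 2 * rho ->
     `|m%:R - t0%:R| <= rho ^+ 2 -> `|w m.+1 y - w m y| <= eps) ->
  exists a' b', b' - a' <= (1 - (2 * CH')^-1) * (b - a) + eps /\
    forall m y, vset G y -> (gdist G x y)%:R < rho / 4 ->
     `|m%:R - t0%:R| <= rho ^+ 2 / 16 -> a' <= w m y <= b'.
Proof.
move=> CH0 CHle Ux phi cw r1 r16 rt wab reg.
have CH'0 : 0 < CH' := lt_le_trans CH0 CHle.
(* The cylinder starts at [tau = t0 - N7], so [t0] lies near 7/8 of its height and the times within
   [T / 16] of it stay between [3 * T / 4] and [T]; [16 <= T] pays for the rounding. *)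
pose T := rho ^+ 2; pose N7 := Num.truncn (7 / 8 * T).
have T16 : 16 <= T := r16.
have [N7l N7u] : N7%:R <= 7 / 8 * T /\ 7 / 8 * T < N7%:R + 1.
  have /andP[? ?] : N7%:R <= 7 / 8 * T < N7.+1%:R by apply: truncn_itv; lra.
  by split=> //; rewrite natr1.
have N7t : (N7 <= t0)%N by rewrite -(ler_nat R); apply: le_trans rt; rewrite -/T; lra.
pose tau := (t0 - N7)%N.
have tauE : tau%:R = t0%:R - N7%:R :> R by rewrite /tau natrB.
pose nm := Num.truncn (T / 2).
have [nml nmu] : nm%:R <= T / 2 /\ T / 2 < nm%:R + 1.
  have /andP[? ?] : nm%:R <= T / 2 < nm.+1%:R by apply: truncn_itv; lra.
  by split=> //; rewrite natr1.
have win n y : n%:R <= T -> vset G y -> (gdist G x y)%:R < rho + 1 ->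
    a <= w (tau + n)%N y <= b.
  move=> nT Uy xy; apply: wab => //; first by apply: lt_le_trans xy _; lra.
  have n0 : 0 <= n%:R :> R by [].
  by rewrite natrD tauE ler_norml -/T; apply/andP; split; lra.
have x0 : (gdist G x x)%:R < rho / 2 by rewrite gdistxx; lra.
have nmS : nm.+1%:R <= T by rewrite -natr1; lra.
have nm4 : T / 4 <= nm%:R <= T / 2 by apply/andP; split; lra.
pose del := b - a; pose g := (2 * CH')^-1.
have lift v : globally_caloric v ->
    (forall n y, n%:R <= T -> vset G y -> (gdist G x y)%:R < rho + 1 ->
      0 <= v (tau + n)%N y) ->
    (forall m y, vset G y -> (gdist G x y)%:R < 2 * rho ->
      `|m%:R - t0%:R| <= rho ^+ 2 -> `|v m.+1 y - v m y| <= eps) ->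
    del <= v (tau + nm).+1 x + v (tau + nm)%N x ->
    forall m y, vset G y -> (gdist G x y)%:R < rho / 4 ->
     `|m%:R - t0%:R| <= rho ^+ 2 / 16 -> g * del - eps <= v m y.
  move=> cv v0 vreg vdel m y Uy xy mt.
  have mt' : `|m%:R - t0%:R| <= T by apply: le_trans mt _; rewrite -/T; lra.
  move: (mt); rewrite -/T ler_norml => /andP[mt1 mt2].
  have taum : (tau <= m)%N by rewrite -(ler_nat R) tauE; lra.
  have := PHI_pointwise CH0 CHle Ux phi (globally_caloric_shift tau cv) v0.
  move=> /(_ nm (m - tau)%N x y Ux Uy x0); rewrite -/T.
  have mE : (m - tau)%:R = m%:R - t0%:R + N7%:R :> R by rewrite natrB// tauE; ring.
  have mS : (m - tau).+1%:R = (m - tau)%:R + 1 :> R by rewrite natr1.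
  have -> : (tau + (m - tau).+1 = m.+1)%N by rewrite addnS subnKC.
  rewrite subnKC// addnS => H.
  have {}H : del <= CH' * (v m.+1 y + v m y).
    apply: le_trans vdel _; apply: H => //; first by lra.
      by rewrite mE; lra.
    by rewrite mS mE; lra.
  have xy2 : (gdist G x y)%:R < 2 * rho by apply: lt_trans xy _; lra.
  have vr := vreg m y Uy xy2 mt'.
  have eps0 : 0 <= eps by apply: le_trans vr.
  have /ler_normlP[_ v1] := vr.
  have : g * del <= g * (CH' * (v m.+1 y + v m y)).
    by apply: ler_wpM2l => //; rewrite /g invr_ge0; lra.
  have -> : g * (CH' * (v m.+1 y + v m y)) = (v m.+1 y + v m y) / 2.
    by rewrite /g; field; lra.
  by lra.
have wab' m y : vset G y -> (gdist G x y)%:R < rho / 4 ->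
    `|m%:R - t0%:R| <= rho ^+ 2 / 16 -> a <= w m y <= b.
  move=> Uy xy mt; apply: wab => //; first by apply: lt_trans xy _; lra.
  by apply: le_trans mt _; rewrite -/T; lra.
have [del1|del1] := leP del ((w (tau + nm).+1 x - a) + (w (tau + nm)%N x - a)).
  exists (a + g * del - eps), b; split; first by rewrite -/del -/g /del; lra.
  move=> m y Uy xy mt; apply/andP; split.
    have /(_ (fun n z => 1 * w n z + (- a))) := lift.
    move=> /(_ (globally_caloric_affine _ _ cw)) H.
    suff : g * del - eps <= 1 * w m y - a by lra.
    apply: H => //.
    - by move=> n z nT Uz xz; case/andP: (win n z nT Uz xz); lra.
    - move=> k z Uz xz kt.
      by rewrite (_ : _ - _ = w k.+1 z - w k z) ?reg//; ring.
    - by rewrite !mul1r.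
  by case/andP: (wab' m y Uy xy mt).
exists a, (b - g * del + eps); split; first by rewrite -/del -/g /del; lra.
move=> m y Uy xy mt; apply/andP; split.
  by case/andP: (wab' m y Uy xy mt).
have /(_ (fun n z => (-1) * w n z + b)) := lift.
move=> /(_ (globally_caloric_affine _ _ cw)) H.
suff : g * del - eps <= (-1) * w m y + b by lra.
apply: H => //.
- by move=> n z nT Uz xz; case/andP: (win n z nT Uz xz); lra.
- move=> k z Uz xz kt.
  by rewrite (_ : _ - _ = - (w k.+1 z - w k z)) ?normrN ?reg//; ring.
- by move: del1; rewrite /del; lra.
Qed.

End Harnack.

(** * Iterated oscillation decay and on-diagonal bounds *)

Section Oscillation.
Context (R : realType) (d : nat) (G : lattice_graph d) (CM : R)
  (mu : 'rV[int]_d -> 'rV[int]_d -> R).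
Hypothesis cond : conductances G CM mu.
Hypothesis G_inf : infinite_set (vset G).
Hypothesis G_conn : graph_connected G.
Implicit Types (x y z : 'rV[int]_d) (w : nat -> 'rV[int]_d -> R).

(** The factor 8 fits [oscillation_step]: the next ball radius [2 * (r / 8)] is the [r / 4] of its
    conclusion, and the next time window [r ^+ 2 / 64] lies in its [r ^+ 2 / 16]. As the smallest
    radius is at least 4 and at least [s0], the PHI and the rounding are under control at all
    scales. *)
Lemma oscillation_decay (CH CH' : R) x (s0 rho : R) w (t0 K : nat) (M eps : R) :
  0 < CH -> CH <= CH' -> 1 <= CH' -> vset G x ->
  (forall r, s0 <= r -> PHI G mu CH x r (r ^+ 2)) ->
  globally_caloric G mu w -> s0 <= rho / 8 ^+ K -> 4 <= rho / 8 ^+ K ->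
  rho ^+ 2 <= t0%:R ->
  (forall m y, vset G y -> (gdist G x y)%:R < 2 * rho ->
     `|m%:R - t0%:R| <= rho ^+ 2 -> 0 <= w m y <= M) ->
  (forall m y, vset G y -> (gdist G x y)%:R < 2 * rho ->
     `|m%:R - t0%:R| <= rho ^+ 2 -> `|w m.+1 y - w m y| <= eps) ->
  forall y y', vset G y -> vset G y' ->
    (gdist G x y)%:R < 2 * (rho / 8 ^+ K) ->
    (gdist G x y')%:R < 2 * (rho / 8 ^+ K) ->
    `|w t0 y - w t0 y'| <= (1 - (2 * CH')^-1) ^+ K * M + K%:R * eps.
Proof.
move=> CH0 CHle CH1 Ux phi cw sK rK rt wM reg y y' Uy Uy' xy xy'.
pose r k := rho / 8 ^+ k.
have r_nincr j k : (j <= k)%N -> 4 <= r k -> r k <= r j.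
  move=> jk rk; rewrite /r; apply: ler_wpM2l.
    have : 0 < r k * 8 ^+ k by rewrite mulr_gt0 ?exprn_gt0// (lt_le_trans _ rk).
    by rewrite /r mulfVK ?expf_neq0// => /ltW.
  by rewrite lef_pV2 ?posrE ?exprn_gt0// ler_weXn2l// ler1n.
have rS k : r k.+1 = r k / 8 by rewrite /r exprSr invfM mulrA.
have r0 : r 0%N = rho by rewrite /r expr0 divr1.
have rK4 k : (k <= K)%N -> 4 <= r k by move=> kK; exact: le_trans rK (r_nincr _ _ kK rK).
have rsq k : (k <= K)%N -> r k ^+ 2 <= rho ^+ 2.
  move=> kK; rewrite ler_pXn2r// ?nnegrE ?(le_trans _ (rK4 _ _))//.
  - by rewrite -r0; apply: r_nincr => //; exact: rK4.
  - by rewrite -r0 (le_trans _ (rK4 0%N _)).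
pose q := 1 - (2 * CH')^-1.
have q01 : 0 <= q <= 1.
  have h0 : 0 <= (2 * CH')^-1 by rewrite invr_ge0; lra.
  have h1 : (2 * CH')^-1 <= 1 by rewrite invf_le1; lra.
  by apply/andP; rewrite /q; split; lra.
case/andP: q01 => q0 q1.
have x0 : (gdist G x x)%:R < 2 * rho.
  by rewrite gdistxx -r0; have := rK4 0%N isT; lra.
have t00 : `|t0%:R - t0%:R| <= rho ^+ 2 by rewrite subrr normr0 sqr_ge0.
have eps0 : 0 <= eps by apply: le_trans (reg t0 x Ux x0 t00).
have main k : (k <= K)%N -> exists a b, b - a <= q ^+ k * M + k%:R * eps /\
    forall m z, vset G z -> (gdist G x z)%:R < 2 * r k ->
      `|m%:R - t0%:R| <= r k ^+ 2 -> a <= w m z <= b.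
  elim: k => [_|k IH kK].
    by exists 0, M; rewrite expr0 mul1r mul0r addr0 subr0; split=> //; rewrite r0.
  have [a [b [ab H]]] := IH (ltnW kK).
  have rk4 := rK4 k.+1 kK; rewrite rS in rk4.
  have rk1 : 1 <= r k by lra.
  have rk16 : 16 <= r k ^+ 2.
    by rewrite (_ : 16 = 4 ^+ 2) ?ler_pXn2r ?nnegrE -?natrX//; lra.
  have rrho : r k <= rho by rewrite -r0; apply: r_nincr => //; exact: rK4 (ltnW kK).
  have rho_k := rsq k (ltnW kK).
  have phik : PHI G mu CH x (r k) (r k ^+ 2).
    by apply: phi; apply: le_trans sK _; apply: r_nincr => //; exact: ltnW.
  have regk m z : vset G z -> (gdist G x z)%:R < 2 * r k ->
      `|m%:R - t0%:R| <= r k ^+ 2 -> `|w m.+1 z - w m z| <= eps.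
    move=> Uz xz mt; apply: reg => //; first by move: xz; lra.
    exact: le_trans mt rho_k.
  have := oscillation_step cond G_conn CH0 CHle Ux phik cw rk1 rk16
    (le_trans rho_k rt) H regk.
  move=> [a' [b' [ab' H']]]; exists a', b'; split.
    apply: le_trans ab' _; rewrite -/q exprS -natr1.
    have := ler_wpM2l q0 ab; have : q * (k%:R * eps) <= k%:R * eps.
      by apply: ler_piMl => //; rewrite mulr_ge0.
    have -> : q * (q ^+ k * M + k%:R * eps) = q * q ^+ k * M + q * (k%:R * eps).
      by ring.
    by rewrite mulrDl mul1r; lra.
  move=> m z Uz xz mt; apply: H' => //.
    by move: xz; rewrite rS; lra.
  have r64 : r k.+1 ^+ 2 = r k ^+ 2 / 64 by rewrite rS; field.
  by move: mt; rewrite r64; lra.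
have [a [b [ab H]]] := main K (leqnn K).
have tK : `|t0%:R - t0%:R| <= r K ^+ 2 by rewrite subrr normr0 sqr_ge0.
have /andP[? ?] := H t0 y Uy xy tK; have /andP[? ?] := H t0 y' Uy' xy' tK.
by rewrite ler_norml; apply/andP; move: ab; rewrite /q; split; lra.
Qed.

Context (disp : measure_display) (Omega : measurableType disp)
  (P : 'rV[int]_d -> probability Omega R) (X : nat -> Omega -> 'rV[int]_d).
Hypothesis chain : markov_chain G mu P X.

(** The PHI compares [p_m(y, y)] with [p_N + p_(N-1)] at every [z] of [L]. Weighted by [mu_z] and
    summed, the latter is at most 2, since the chain has total mass 1 at each of the two times. *)
Lemma tdensity_diag_le (CH CH' : R) x (rho : R) y m (L : {fset 'rV[int]_d}) :
  0 < CH -> CH <= CH' -> vset G x -> PHI G mu CH x rho (rho ^+ 2) ->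
  0 < rho -> 16 <= rho ^+ 2 -> vset G y -> (gdist G x y)%:R < rho / 2 ->
  (forall z, z \in L -> vset G z /\ (gdist G x z)%:R < rho / 2) ->
  rho ^+ 2 / 4 <= m%:R <= rho ^+ 2 / 2 ->
  tdensity (vset G) mu m y y * (\sum_(z <- L) vweight G mu z) <= 2 * CH'.
Proof.
move=> CH0 CHle Ux phi r0 r16 Uy xy LU /andP[m1 m2].
have CH'0 : 0 < CH' := lt_le_trans CH0 CHle.
pose p n z := tdensity (vset G) mu n y z.
have p0 n z : vset G z -> 0 <= p n z.
  by move=> Uz; apply: tdensity_ge0 => //; [exact: cond_ge0 cond|
    exact: vweight_gt0 cond G_inf G_conn].
pose N := Num.truncn (rho ^+ 2).
have [Nl Nu] : N%:R <= rho ^+ 2 /\ rho ^+ 2 < N%:R + 1.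
  have /andP[? ?] : N%:R <= rho ^+ 2 < N.+1%:R by apply: truncn_itv; lra.
  by split=> //; rewrite natr1.
have N0 : (0 < N)%N by rewrite -(ltr_nat R); lra.
have N1 : N.-1%:R = N%:R - 1 :> R by rewrite -[in RHS](prednK N0) -natr1; ring.
have mS : m.+1%:R = m%:R + 1 :> R by rewrite natr1.
have H z : z \in L -> p m y <= CH' * (p N z + p N.-1 z).
  move=> /LU[Uz xz].
  have := PHI_pointwise G_conn CH0 CHle Ux phi (tdensity_caloric cond G_inf G_conn y).
  move=> /(_ (fun n z' _ Uz' _ => p0 n z' Uz') m N.-1 y z Uy Uz xy xz).
  rewrite prednK// m1 m2 mS N1 => /(_ isT) h.
  have h1 : m%:R + 1 <= rho ^+ 2 by lra.
  have h2 : 3 * rho ^+ 2 / 4 <= N%:R - 1 by lra.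
  by apply: le_trans (h h1 h2 Nl); rewrite lerDr; exact: (p0 m.+1).
have prob n : \sum_(z <- L) vweight G mu z * p n z <= 1.
  apply: le_trans (prob_fset_le1 chain y n L).
  rewrite big_seq_cond [leRHS]big_seq_cond; apply: ler_sum => z /andP[/LU[Uz _] _].
  by rewrite (prob_tdensity chain cond).
rewrite mulrC mulr_suml.
apply: (@le_trans _ _ (\sum_(z <- L)
    CH' * (vweight G mu z * p N z + vweight G mu z * p N.-1 z))).
  rewrite big_seq_cond [leRHS]big_seq_cond; apply: ler_sum => z /andP[zL _].
  rewrite -mulrDr mulrCA; apply: ler_wpM2l; last exact: H.
  by apply/ltW/(vweight_gt0 cond G_inf G_conn); case: (LU z zL).
rewrite -mulr_sumr big_split/= mulrC; apply: ler_wpM2r; first exact: ltW.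
by have := prob N; have := prob N.-1; lra.
Qed.

End Oscillation.

(** * Integrals over cubes and the Gauss kernel *)

Section LebesgueCube.
Context (R : realType).

Lemma measurable_box d (a : nat -> R) (r : R) :
  measurable [set v : d.-tuple (measurableTypeR R) |
    forall i : 'I_d, a i - r <= tnth v i <= a i + r].
Proof.
rewrite [X in measurable X](_ : _ = \bigcap_(i in [set: 'I_d])
    ((fun v : d.-tuple (measurableTypeR R) => tnth v i) @^-1` `[a i - r, a i + r])).
  apply: fin_bigcap_measurable => // i _.
  rewrite -[X in measurable X]setTI.
  exact: (measurable_tnth i measurableT (measurable_itv _)).
apply/seteqP; split => v /= H i; first by move=> _; rewrite /= in_itv/= H.
by have := H i I; rewrite /= in_itv.
Qed.

Lemma lebesgue_tuple_box d (a : nat -> R) (r : R) : 0 <= r ->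
  lebesgue_tuple R d [set v | forall i : 'I_d, a i - r <= tnth v i <= a i + r] =
  ((2 * r) ^+ d)%:E.
Proof.
move=> r0; elim: d a => [|d IH] a.
  by rewrite /= diracE mem_set// => -[].
rewrite /= /lebesgue_cons /= /pushforward.
rewrite [X in (_ \x _)%E X](_ : _ =
   [set v : d.-tuple (measurableTypeR R) |
     forall i : 'I_d, a i.+1 - r <= tnth v i <= a i.+1 + r] `*`
   [set` `[a 0%N - r, a 0%N + r]]).
  rewrite product_measure1E//; last exact: (measurable_box (fun i => a i.+1)).
  rewrite exprSr EFinM; congr (_ * _)%E; first exact: (IH (fun i => a i.+1)).
  etransitivity; first exact: lebesgue_measure_itv.
  rewrite /= lte_fin; case: ltP => h; last by congr EFin; lra.
  by rewrite -EFinB; congr EFin; ring.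
apply/seteqP; split => -[v x] /=; rewrite in_itv /=.
  move=> H; split; last by have := H ord0; rewrite tnth0.
  by move=> i; have := H (lift ord0 i); rewrite tnthS.
move=> [H Hx] i; case: (unliftP ord0 i) => [j|] ->; last by rewrite tnth0.
by rewrite tnthS; exact: H.
Qed.

(** Centres of boxes are indexed by [nat], which lets the induction on the dimension shift the
    index; [coord] extends [y] by 0 beyond [d]. *)
Let coord d (y : 'rV[R]_d) (n : nat) : R := odflt 0 (omap (y 0) (insub n)).

Lemma row_of_tuple_cube d (y : 'rV[R]_d) (r : R) :
  [set v | cube y r (row_of_tuple v)] =
  [set v | forall i : 'I_d, coord y i - r <= tnth v i <= coord y i + r].
Proof.
have cE (i : 'I_d) : coord y i = y 0 i by rewrite /coord valK.
by apply/seteqP; split => v H i; have := H i; rewrite mxE cE.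
Qed.

Lemma measurable_cube d (y : 'rV[R]_d) (r : R) :
  measurable [set v : d.-tuple (measurableTypeR R) | cube y r (row_of_tuple v)].
Proof. by rewrite row_of_tuple_cube; exact: measurable_box. Qed.

Lemma lebesgue_tuple_cube d (y : 'rV[R]_d) (r : R) : 0 <= r ->
  lebesgue_tuple R d [set v | cube y r (row_of_tuple v)] = ((2 * r) ^+ d)%:E.
Proof. by move=> r0; rewrite row_of_tuple_cube lebesgue_tuple_box. Qed.

Lemma integral_cube_approx d (y : 'rV[R]_d) (r c k : R) (f : 'rV[R]_d -> R) :
  0 <= r -> measurable_fun setT (f \o @row_of_tuple R d) ->
  (forall v, cube y r v -> `|f v - c| <= k) ->
  `|integral_cube y r f - c * (2 * r) ^+ d| <= k * (2 * r) ^+ d.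
Proof.
move=> r0 mf fc; have mC := measurable_cube y r.
have volE := lebesgue_tuple_cube y r0.
have fin : (lebesgue_tuple R d [set v | cube y r (row_of_tuple v)] < +oo)%E.
  by rewrite volE ltry.
have icst (b : R) : (lebesgue_tuple R d).-integrable
    [set v | cube y r (row_of_tuple v)] (EFin \o cst b).
  by apply: measurable_bounded_integrable => //; exact: bounded_cst.
have fcb v : cube y r (row_of_tuple v) -> c - k <= f (row_of_tuple v) <= c + k.
  by move=> /fc; rewrite ler_norml => /andP[? ?]; apply/andP; split; lra.
have intf : (lebesgue_tuple R d).-integrable
    [set v | cube y r (row_of_tuple v)] (EFin \o (f \o @row_of_tuple R d)).
  apply: measurable_bounded_integrable => //.
    exact: measurable_funS mf.
  exists (`|c| + k); split; first exact: num_real.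
  move=> x cx v /= Cv; apply: le_trans (ltW cx).
  have : `|f (row_of_tuple v) - c + c| <= k + `|c|.
    by apply: le_trans (ler_normD _ _) _; rewrite lerD2r fc.
  by rewrite subrK addrC.
have lo : (c - k) * (2 * r) ^+ d <= integral_cube y r f.
  rewrite (_ : _ * _ = \int[lebesgue_tuple R d]_(v in
    [set v | cube y r (row_of_tuple v)]) (c - k)); last by rewrite Rintegral_cst// volE.
  by apply: le_Rintegral => [//|||v /fcb /andP[]//]; [exact: icst|exact: intf].
have up : integral_cube y r f <= (c + k) * (2 * r) ^+ d.
  rewrite [leRHS](_ : _ * _ = \int[lebesgue_tuple R d]_(v in
    [set v | cube y r (row_of_tuple v)]) (c + k)); last by rewrite Rintegral_cst// volE.
  by apply: le_Rintegral => [//|||v /fcb /andP[]//]; [exact: intf|exact: icst].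
by rewrite ler_norml; apply/andP; split; lra.
Qed.

End LebesgueCube.

(** * The Gauss kernel and its modulus of continuity *)

Section Gauss.
Context (R : realType) (d : nat).
Implicit Types (x v : 'rV[R]_d) (D t : R).

Lemma l2norm_sqr x : l2norm x ^+ 2 = \sum_i x 0 i ^+ 2.
Proof. by rewrite sqr_sqrtr// sumr_ge0// => i _; rewrite sqr_ge0. Qed.

Lemma gauss_ge0 D t x : 0 <= gauss D t x.
Proof. by rewrite mulr_ge0 ?powR_ge0 ?expR_ge0. Qed.

Lemma measurable_gauss D t :
  measurable_fun setT (gauss D t \o @row_of_tuple R d).
Proof.
rewrite [X in measurable_fun _ X](_ : _ = fun v : d.-tuple (measurableTypeR R) =>
  (2 * pi * t * D) `^ (- (d%:R / 2)) *
  expR (- ((2 * D * t)^-1 * \sum_(i < d) tnth v i ^+ 2))); last first.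
  apply/funext => v; rewrite /= /gauss l2norm_sqr (mulrC (\sum_i _)).
  by congr (_ * expR (- (_ * _))); apply: eq_bigr => i _; rewrite mxE.
apply: measurable_funM => //; apply: measurableT_comp => //.
apply: measurableT_comp => //; apply: measurable_funM => //.
apply: measurable_sum => i; apply: measurable_funX.
exact: measurable_tnth.
Qed.

(** This crude decay is enough: the spatial tails only have to vanish at infinity, at no particular
    rate. *)
Lemma expRN_le_inv (u : R) : 0 < u -> expR (- u) <= u^-1.
Proof.
move=> u0; rewrite expRN lef_pV2 ?posrE ?expR_gt0//.
by apply: le_trans (expR_ge1Dx u); rewrite lerDr.
Qed.

Lemma expR_lipschitz (a b c : R) : a <= c -> b <= c ->
  `|expR a - expR b| <= expR c * `|a - b|.
Proof.
have key (p q : R) : p <= c -> q <= p -> expR p - expR q <= expR c * (p - q).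
  move=> pc qp; have -> : expR p - expR q = expR p * (1 - expR (q - p)).
    by rewrite mulrBr mulr1 -expRD addrCA subrr addr0.
  apply: ler_pM; rewrite ?expR_ge0 ?ler_expR//.
    by rewrite subr_ge0 -[leRHS](@expR0 R) ler_expR subr_le0.
  by have := expR_ge1Dx (q - p); lra.
move=> ac bc; have [ab|ab] := leP a b.
  rewrite distrC (distrC a) !ger0_norm ?subr_ge0 ?ler_expR//; exact: key.
by rewrite !ger0_norm ?subr_ge0 ?ler_expR// ?(ltW ab)//; apply: key => //; exact: ltW.
Qed.

Lemma ln_dist_le (T1 s t : R) : 0 < T1 -> T1 <= s -> T1 <= t ->
  `|ln s - ln t| <= `|s - t| / T1.
Proof.
have key (p q : R) : 0 < T1 -> T1 <= q -> q <= p -> ln p - ln q <= (p - q) / T1.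
  move=> T0 Tq qp; have q0 : 0 < q := lt_le_trans T0 Tq.
  have p0 : 0 < p := lt_le_trans q0 qp.
  rewrite -ln_div ?posrE//.
  have -> : p / q = 1 + (p - q) / q by field; rewrite gt_eqF.
  apply: (@le_trans _ _ ((p - q) / q)).
    apply: le_ln1Dx; apply: (@lt_le_trans _ _ 0); first by lra.
    by rewrite divr_ge0 ?subr_ge0// ltW.
  by rewrite ler_wpM2l ?subr_ge0// lef_pV2 ?posrE.
move=> T0 Ts Tt; have s0 := lt_le_trans T0 Ts; have t0 := lt_le_trans T0 Tt.
have [st|st] := leP s t.
  rewrite distrC (distrC s) !ger0_norm ?subr_ge0 ?ler_ln ?posrE//; exact: key.
rewrite !ger0_norm ?subr_ge0 ?ler_ln ?posrE// ?(ltW st)//.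
by apply: key => //; exact: ltW.
Qed.

Lemma sum_sqr_dist x v (K r : R) : 0 <= r -> `|x| <= K -> `|v - x| <= r ->
  `|\sum_i x 0 i ^+ 2 - \sum_i v 0 i ^+ 2| <= d%:R * (r * (2 * K + r)).
Proof.
move=> r0 xK vx; rewrite -sumrB; apply: le_trans (ler_norm_sum _ _ _) _.
rewrite -[d in leRHS]card_ord mulr_natl -sumr_const; apply: ler_sum => i _.
have xi : `|x 0 i| <= K := le_trans (row_coord_le x i) xK.
have vi : `|v 0 i - x 0 i| <= r.
  by apply: le_trans vx; have := row_coord_le (v - x) i; rewrite !mxE.
rewrite subr_sqr normrM; apply: ler_pM => //; first by rewrite distrC.
have -> : x 0 i + v 0 i = (2 * x 0 i) + (v 0 i - x 0 i) by ring.
apply: le_trans (ler_normD _ _) _; rewrite normrM ger0_norm//.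
by apply: lerD => //; rewrite ler_pM2l.
Qed.

(** Written as one exponential, the kernel inherits its modulus of continuity from the exponent. *)
Lemma gaussE D t x : 0 < D -> 0 < t -> gauss D t x =
  expR (- (d%:R / 2) * ln (2 * pi * t * D) - (\sum_i x 0 i ^+ 2) / (2 * D * t)).
Proof.
move=> D0 t0; rewrite /gauss l2norm_sqr /powR gt_eqF ?expRD//.
by rewrite !mulr_gt0// pi_gt0.
Qed.

Lemma gauss_modulus D (T1 K k : R) : 0 < D -> 0 < T1 -> 0 <= K -> 0 < k ->
  exists2 r, 0 < r & forall t t' x v, T1 <= t -> T1 <= t' -> `|t' - t| <= r ->
    `|x| <= K -> `|v - x| <= r -> `|gauss D t' v - gauss D t x| <= k.
Proof.
move=> D0 T0 K0 k0.
(* [c] bounds the exponent at all times from [T1] on; the three terms of [C] bound its variation per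
   unit of [r] through [ln t], through [|x|^2] and through [1 / t]. *)
pose c := - (d%:R / 2) * ln (2 * pi * T1 * D).
pose C : R := d%:R / 2 / T1 + d%:R * (2 * K + 1) / (2 * D * T1) +
  d%:R * (K + 1) ^+ 2 / (2 * D * T1 ^+ 2).
have C0 : 0 <= C.
  have D0' := ltW D0; have T0' := ltW T0.
  have K1 : 0 <= 2 * K + 1 by lra.
  have sq y : 0 <= y ^+ 2 :> R by rewrite sqr_ge0.
  by repeat (apply: addr_ge0 || apply: divr_ge0 || apply: mulr_ge0) => //.
have E0 := expR_gt0 c.
pose r := Num.min 1 (k / (expR c * C + 1)).
have EC0 : 0 < expR c * C + 1 by rewrite ltr_wpDl// mulr_ge0// ltW.
have r0 : 0 < r by rewrite /r lt_min ltr01 divr_gt0.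
exists r => // t t' x v Tt Tt' tt' xK vx.
have r1 : r <= 1 by rewrite /r ge_min lexx.
have rk : r * (expR c * C + 1) <= k.
  by rewrite -ler_pdivlMr// /r ge_min lexx orbT.
have t0 := lt_le_trans T0 Tt; have t'0 := lt_le_trans T0 Tt'.
have pi0 := pi_gt0 R.
have phic s y : T1 <= s ->
    - (d%:R / 2) * ln (2 * pi * s * D) - (\sum_i (y : 'rV[R]_d) 0 i ^+ 2) / (2 * D * s) <= c.
  move=> Ts; have s0 := lt_le_trans T0 Ts.
  rewrite -[leRHS]subr0 lerB//.
    rewrite ler_wnM2l ?oppr_le0 ?divr_ge0// ler_ln ?posrE ?mulr_gt0//.
    by rewrite ler_pM2r// ler_pM2l ?mulr_gt0.
  by rewrite divr_ge0 ?sumr_ge0 ?mulr_ge0 ?ltW// => i _; rewrite sqr_ge0.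
rewrite !gaussE//; apply: le_trans (expR_lipschitz (phic _ _ Tt') (phic _ _ Tt)) _.
set S' := \sum_i v 0 i ^+ 2; set S := \sum_i x 0 i ^+ 2.
have SS : `|S' - S| <= d%:R * (r * (2 * K + 1)).
  rewrite distrC; apply: le_trans (sum_sqr_dist (ltW r0) xK vx) _.
  by rewrite ler_wpM2l// ler_wpM2l ?(ltW r0)//; lra.
have S0 : 0 <= S by rewrite sumr_ge0// => i _; rewrite sqr_ge0.
have SK : S <= d%:R * (K + 1) ^+ 2.
  rewrite -[d in leRHS]card_ord mulr_natl -sumr_const; apply: ler_sum => i _.
  rewrite -[leLHS]real_normK ?num_real// ler_pXn2r ?nnegrE ?addr_ge0//.
  by apply: le_trans (row_coord_le x i) (le_trans xK _); rewrite lerDl.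
have lnE s : 0 < s -> ln (2 * pi * s * D) = ln s + ln (2 * pi * D).
  by move=> s0; rewrite -lnM ?posrE ?mulr_gt0//; congr ln; ring.
rewrite !lnE//.
have -> : - (d%:R / 2) * (ln t' + ln (2 * pi * D)) - S' / (2 * D * t') -
    (- (d%:R / 2) * (ln t + ln (2 * pi * D)) - S / (2 * D * t)) =
    - (d%:R / 2) * (ln t' - ln t) - (S' - S) / (2 * D * t')
    + S * (t' - t) / (2 * D * (t * t')).
  by field; rewrite !gt_eqF.
apply: (@le_trans _ _ (expR c * (r * C))); last first.
  apply: le_trans rk; by rewrite mulrCA ler_pM2l// lerDl ler01.
rewrite ler_pM2l//.
have b1 : `|- (d%:R / 2) * (ln t' - ln t)| <= r * (d%:R / 2 / T1).
  rewrite normrM normrN (ger0_norm (_ : 0 <= d%:R / 2)) ?divr_ge0//.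
  have -> : r * (d%:R / 2 / T1) = d%:R / 2 * (r / T1) by ring.
  apply: ler_wpM2l; first by rewrite divr_ge0.
  apply: le_trans (ln_dist_le T0 Tt' Tt) _.
  by rewrite ler_pM2r ?invr_gt0.
have b2 : `|(S' - S) / (2 * D * t')| <= r * (d%:R * (2 * K + 1) / (2 * D * T1)).
  rewrite normrM normfV (ger0_norm (_ : 0 <= 2 * D * t')); last first.
    by rewrite !mulr_ge0// ltW.
  have -> : r * (d%:R * (2 * K + 1) / (2 * D * T1)) =
    d%:R * (r * (2 * K + 1)) / (2 * D * T1) by ring.
  apply: ler_pM => //; first by rewrite invr_ge0 !mulr_ge0// ltW.
  by rewrite lef_pV2 ?posrE ?mulr_gt0// ler_pM2l ?mulr_gt0.
have b3 : `|S * (t' - t) / (2 * D * (t * t'))| <=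
    r * (d%:R * (K + 1) ^+ 2 / (2 * D * T1 ^+ 2)).
  rewrite normrM normfV (ger0_norm (_ : 0 <= 2 * D * (t * t'))); last first.
    by rewrite !mulr_ge0// ltW.
  have -> : r * (d%:R * (K + 1) ^+ 2 / (2 * D * T1 ^+ 2)) =
    (d%:R * (K + 1) ^+ 2 * r) / (2 * D * T1 ^+ 2) by ring.
  apply: ler_pM => //; first by rewrite invr_ge0 !mulr_ge0// ltW.
    by rewrite normrM (ger0_norm S0); apply: ler_pM.
  rewrite lef_pV2 ?posrE ?mulr_gt0 ?exprn_gt0//; apply: ler_wpM2l.
    by rewrite mulr_ge0// ltW.
  by rewrite expr2; apply: ler_pM => //; exact: ltW.
apply: le_trans (ler_normD _ _) _.
rewrite /C !(mulrDr r); apply: lerD => //.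
by apply: le_trans (ler_normB _ _) _; exact: lerD.
Qed.

End Gauss.

(** * Lattice points and their asymptotics *)

Section Asymptotics.
Context (R : realType).

Lemma cvg_eventually (u : nat -> R) (l e : R) : u n @[n --> \oo] --> l -> 0 < e ->
  exists N, forall n, (N <= n)%N -> `|u n - l| <= e.
Proof.
move=> /cvgrPdist_le ul e0; have [N _ H] := ul e e0.
by exists N => n Nn; rewrite distrC; exact: H.
Qed.

Lemma sqrt_eventually_ge (A : R) : exists N, forall n, (N <= n)%N ->
  A <= Num.sqrt n%:R.
Proof.
exists (Num.truncn (A ^+ 2)).+1 => n Nn.
have [A0|A0] := leP A 0; first by rewrite (le_trans A0)// sqrtr_ge0.
rewrite -[leLHS](gtr0_norm A0) -sqrtr_sqr ler_wsqrtr//.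
by apply: le_trans (ltW (truncnS_gt _)) _; rewrite ler_nat.
Qed.

Lemma nat_eventually_ge (A : R) : exists N, forall n, (N <= n)%N -> A <= n%:R.
Proof.
exists (Num.truncn A).+1 => n Nn.
by apply: le_trans (ltW (truncnS_gt _)) _; rewrite ler_nat.
Qed.

Lemma powR_half n d : n%:R `^ (d%:R / 2) = Num.sqrt n%:R ^+ d :> R.
Proof.
by rewrite mulrC powRrM powR12_sqrt// powR_mulrn// sqrtr_ge0.
Qed.

(** The inequality amounts to [n ^ (- delta) <= e]. It absorbs the second branch of the maximum in
    (e) at scale sqrt n. *)
Lemma powR_lt_sqrt (delta e : R) : 0 < delta -> 0 < e ->
  exists N, forall n, (N <= n)%N -> n%:R `^ (1 / 2 - delta) <= e * Num.sqrt n%:R.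
Proof.
move=> delta0 e0; have [N HN] := nat_eventually_ge ((e^-1) `^ delta^-1).
exists (maxn N 1) => n; rewrite geq_max => /andP[Nn n0].
have n1 : 0 < n%:R :> R by rewrite ltr0n.
have n0' : n%:R != 0 :> R by rewrite gt_eqF.
rewrite powRB ?n0' ?implybT// mul1r powR12_sqrt// mulrC.
apply: ler_wpM2r; first exact: sqrtr_ge0.
rewrite -[leRHS]invrK lef_pV2 ?posrE ?invr_gt0 ?powR_gt0//.
have -> : e^-1 = (e^-1 `^ delta^-1) `^ delta.
  by rewrite -powRrM mulVf ?gt_eqF// powRr1// invr_ge0 ltW.
apply: ge0_ler_powR; rewrite ?nnegrE ?powR_ge0//; first exact: ltW.
exact: HN.
Qed.

Lemma finite_eventually (T : choiceType) (A : set T) (Q : T -> nat -> Prop) :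
  finite_set A ->
  (forall a, A a -> exists N, forall n, (N <= n)%N -> Q a n) ->
  exists N, forall n, (N <= n)%N -> forall a, A a -> Q a n.
Proof.
move=> fA H.
(* The choice function needs a threshold at every point; outside [A] any value will do. *)
have H' : forall a, exists N, A a -> forall n, (N <= n)%N -> Q a n.
  move=> a; have [Aa|nAa] := pselect (A a); last by exists 0%N.
  by have [N HN] := H a Aa; exists N.
have [f Hf] := choice H'.
exists (\max_(a <- fset_set A) f a)%N => n Nn a Aa; apply: (Hf a Aa).
apply: leq_trans Nn.
by apply: (leq_bigmax_seq (P := xpredT)) => //; rewrite in_fset_set// mem_set.
Qed.

End Asymptotics.

(** * Closest vertices and holes *)

Section LatticePoints.
Context (R : realType) (d : nat) (G : lattice_graph d).
Implicit Types (x y : 'rV[R]_d) (z : 'rV[int]_d).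

Lemma cubeP x y (r : R) : 0 <= r -> cube x r y <-> `|y - x| <= r.
Proof.
move=> r0; split => [H|H i].
  apply: row_norm_le => // i; rewrite !mxE ler_norml; have := H i.
  by move=> /andP[? ?]; apply/andP; split; lra.
have := le_trans (row_coord_le (y - x) i) H; rewrite !mxE ler_norml.
by move=> /andP[? ?]; apply/andP; split; lra.
Qed.

Lemma finite_emb_ball x (r : R) : finite_set [set z | `|emb R z - x| <= r].
Proof.
apply: sub_finite_set (finite_int_box d (Num.truncn (`|x| + r)).+1) => z zr i /=.
have h : `|emb R z| <= `|x| + r.
  by rewrite -[emb R z](subrK x) addrC (le_trans (ler_normD _ _))// lerD2l.
have := le_trans (row_coord_le (emb R z) i) h; rewrite mxE -intr_norm.
move=> /le_lt_trans/(_ (truncnS_gt _)); rewrite -[X in _ < X]mulrz_nat ltr_int natz.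
exact: ltW.
Qed.

Lemma finite_Lam x (r : R) : finite_set (Lam G x r).
Proof.
have [r0|r0] := leP 0 r.
  apply: sub_finite_set (finite_emb_ball x r) => z [_ /cubeP]; exact.
apply: sub_finite_set (finite_emb_ball x 0) => z [_ H] /=.
apply: row_norm_le => // i; have /andP[h1 h2] := H i; lra.
Qed.

Lemma closestP (le : rel 'rV[int]_d) n x :
  total le -> transitive le -> vset G 0 ->
  vset G (closest G le n x) /\ forall z, vset G z ->
    `|emb R (closest G le n x) - Num.sqrt n%:R *: x| <=
    `|emb R z - Num.sqrt n%:R *: x|.
Proof.
move=> le_total le_trans' U0; set y := Num.sqrt n%:R *: x.
suff [z Hz] : exists z, closest_spec G le y z.
  rewrite /closest; case: xgetP => [w _ [Uw min _]|H]; first by [].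
  by case: (H z Hz).
pose A := [set z | vset G z /\ `|emb R z - y| <= `|emb R 0 - y|].
have fA : finite_set A by apply: sub_finite_set (finite_emb_ball y `|emb R 0 - y|) => z [].
pose dist z := `|emb R z - y|.
have A0 : 0 \in fset_set A by rewrite in_fset_set// mem_set.
have inA z : z \in fset_set A -> vset G z by rewrite in_fset_set// inE => -[].
have min_ex (B : seq 'rV[int]_d) (rl : rel 'rV[int]_d) : total rl -> transitive rl ->
    B != [::] -> exists2 z, z \in B & forall z', z' \in B -> rl z z'.
  move=> rt rtr; elim: B => // b B IH _; have rr z : rl z z.
    by have := rt z z; rewrite orbb.
  have [->|/IH[z zB zm]] := eqVneq B [::].
    by exists b; rewrite ?inE// => z'; rewrite inE => /eqP ->.
  have [bz|zb] := orP (rt b z).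
    exists b; rewrite ?inE ?eqxx// => z'; rewrite inE => /orP[/eqP ->//|/zm].
    exact: rtr.
  exists z; rewrite ?inE ?zB ?orbT// => z'; rewrite inE => /orP[/eqP ->//|/zm//].
pose rl z z' := (dist z < dist z') || ((dist z == dist z') && le z z').
have rl_total : total rl.
  move=> z z'; rewrite /rl; case: (ltgtP (dist z) (dist z')) => //= _.
have rl_trans : transitive rl.
  move=> b a c; rewrite /rl; case/orP => [ab|/andP[/eqP ab lab]].
    by case/orP => [bc|/andP[/eqP <- _]]; rewrite ?(lt_trans ab bc)// ab.
  case/orP => [bc|/andP[/eqP bc lbc]]; first by rewrite ab bc.
  by rewrite ab bc eqxx (le_trans' _ _ _ lab lbc) orbT.
have [|z zA zmin] := min_ex (fset_set A) rl rl_total rl_trans.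
  by apply/eqP => E; move: A0; rewrite -[0 \in _]/(0 \in (fset_set A : seq _)) E.
(* A vertex farther away than 0 loses to 0, hence to the minimum over [A]. *)
have zm z' : vset G z' -> rl z z'.
  move=> Uz'; have [h|h] := leP (dist z') (dist 0).
    by apply: zmin; rewrite in_fset_set// mem_set.
  apply/orP; left; apply: le_lt_trans h.
  by have := zmin 0 A0; rewrite /rl => /orP[/ltW//|/andP[/eqP -> _]].
exists z; split; first exact: inA.
  by move=> z' /zm; rewrite /rl => /orP[/ltW//|/andP[/eqP /= + _]]; rewrite /dist => ->.
move=> z' /zm; rewrite /rl /dist => + E; rewrite E ltxx eqxx.
exact.
Qed.

(** The supremum in [hole] is meaningful only over a bounded set: a cube centred in [H(0, |x|)] with
    radius above [|x|] contains the vertex 0, so [|x|] is an upper bound. *)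
Lemma hole_ge x (r : R) : vset G 0 -> 0 <= r ->
  Lam G x r = set0 -> r <= hole G `|x|.
Proof.
move=> U0 r0 L0; rewrite /hole; apply: ub_le_sup.
  exists `|x| => r' [y yx Ly].
  have [//|r'x] := leP r' `|x|.
  suff : Lam G y r' 0 by rewrite Ly.
  split=> //; apply/cubeP; first exact: le_trans (ltW r'x).
  apply: le_trans (ltW r'x); rewrite (_ : emb R 0 = 0); last first.
    by apply/rowP => i; rewrite !mxE.
  by move/cubeP: yx; rewrite subr0 sub0r normrN; exact.
by exists x => //; apply/cubeP; rewrite ?subr0.
Qed.

End LatticePoints.

(** * The local limit theorem *)

Section LocalLimit.
Context (R : realType) (d : nat) (G : lattice_graph d)
  (CM : R) (mu : 'rV[int]_d -> 'rV[int]_d -> R)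
  (disp : measure_display) (Omega : measurableType disp)
  (P : 'rV[int]_d -> probability Omega R)
  (X : nat -> Omega -> 'rV[int]_d)
  (le : rel 'rV[int]_d)
  (T1 D delta CH C1 C2 C3 C4 aG : R) (s : 'rV[int]_d -> R).
Hypothesis d2 : (2 <= d)%N.
Hypothesis G_inf : infinite_set (vset G).
Hypothesis G_conn : graph_connected G.
Hypothesis G0 : vset G 0.
Hypothesis cond : conductances G CM mu.
Hypothesis chain : markov_chain G mu P X.
Hypotheses (le_tot : total le) (le_tr : transitive le).
Hypothesis T1_gt0 : 0 < T1.
Hypotheses (D_gt0 : 0 < D) (delta_gt0 : 0 < delta) (CH_gt0 : 0 < CH).
Hypotheses (C1_gt0 : 0 < C1) (C2_gt0 : 0 < C2) (C3_gt0 : 0 < C3)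
  (C4_gt0 : 0 < C4) (aG_gt0 : 0 < aG).
Hypothesis clt : forall (I : set R) (y : 'rV[R]_d) (r : R),
  compact I -> I `<=` [set t | 0 < t] -> 0 < r ->
  {uniform I,
    (fun (n : nat) (t : R) =>
       fine (P 0 [set w | cube y r (rescaled X n t w)])) @ \oo -->
    (fun t : R => integral_cube y r (gauss D t))}.
Hypothesis gauss_bound : forall (k : nat) (x : 'rV[int]_d), C3 <= k%:R -> vset G x ->
  heat_kernel_hat G mu P X k%:R 0 x <=
    C2 * k%:R `^ (- (d%:R / 2)) * expR (- (C4 * (gdist G 0 x)%:R ^+ 2 / k%:R)).
Hypothesis phi : forall (y : 'rV[int]_d) (rho : R), vset G y -> s y <= rho ->
  PHI G mu CH y rho (rho ^+ 2).
Hypothesis small_holes : hole G r / r @[r --> +oo%R] --> (0 : R).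
Hypothesis rational_points : forall q : 'rV[rat]_d,
  let x : 'rV[R]_d := map_mx ratr q in
  [/\ forall r : R, 0 < r ->
        vol G mu (Lam_n G n x r) / (2 * Num.sqrt n%:R * r) ^+ d
          @[n --> \oo] --> aG,
      forall r : R, 0 < r ->
        exists n0 : nat, forall n : nat, (n0 <= n)%N ->
          forall x' y', Lam_n G n x r x' -> Lam_n G n x r y' ->
            `|emb R x' - emb R y'| <= (gdist G x' y')%:R
            /\ (gdist G x' y')%:R <=
               Num.max (C1 * `|emb R x' - emb R y'|)
                       (n%:R `^ (1 / 2 - delta)) &
      (Num.sqrt n%:R)^-1 * s (closest G le n x) @[n --> \oo] --> (0 : R)].

Local Notation p := (tdensity (vset G) mu).
Local Notation sq n := (Num.sqrt n%:R : R).
Local Notation point n x := (closest G le n x).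
Local Notation qpt q := (map_mx (ratr : rat -> R) q).
Let hat (k : nat) (z : 'rV[int]_d) : R := p k 0 z + p k.+1 0 z.

Lemma p_ge0 n x y : vset G x -> vset G y -> 0 <= p n x y.
Proof.
by move=> Ux Uy; apply: tdensity_ge0 => //; [exact: cond_ge0 cond|
  exact: vweight_gt0 cond G_inf G_conn].
Qed.

Lemma hat_ge0 k z : vset G z -> 0 <= hat k z.
Proof. by move=> Uz; rewrite addr_ge0// p_ge0. Qed.

Lemma heat_kernel_hatE (t : R) z : vset G z ->
  heat_kernel_hat G mu P X t 0 z = hat (Num.truncn t) z.
Proof.
by move=> Uz; rewrite /heat_kernel_hat !(heat_kernelE chain cond G_inf G_conn).
Qed.

Lemma hat_gauss_bound (c : R) n k z : 0 < c -> (0 < n)%N -> c * n%:R <= k%:R ->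
  C3 <= k%:R -> vset G z ->
  hat k z <= C2 * c `^ (- (d%:R / 2)) *
    expR (- (C4 * (gdist G 0 z)%:R ^+ 2 / k%:R)) / sq n ^+ d.
Proof.
move=> c0 n0 cnk C3k Uz.
have := gauss_bound C3k Uz; rewrite heat_kernel_hatE// natrK => /le_trans; apply.
rewrite [leRHS]mulrAC ler_wpM2r ?expR_ge0// -mulrA ler_pM2l//.
have n0' : 0 < n%:R :> R by rewrite ltr0n.
rewrite -powR_half -powRN -powRM ?(ltW c0)// !powRN.
have k0 : 0 < k%:R :> R := lt_le_trans C3_gt0 C3k.
rewrite lef_pV2 ?posrE ?powR_gt0 ?mulr_gt0//.
by apply: ge0_ler_powR; rewrite ?nnegrE ?mulr_ge0 ?(ltW c0)// divr_ge0.
Qed.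

Lemma hat_le (c : R) n k z : 0 < c -> (0 < n)%N -> c * n%:R <= k%:R ->
  C3 <= k%:R -> vset G z -> hat k z <= C2 * c `^ (- (d%:R / 2)) / sq n ^+ d.
Proof.
move=> c0 n0 cnk C3k Uz; apply: le_trans (hat_gauss_bound c0 n0 cnk C3k Uz) _.
rewrite ler_wpM2r ?invr_ge0 ?exprn_ge0 ?sqrtr_ge0//.
rewrite ler_piMr ?mulr_ge0 ?powR_ge0 ?(ltW C2_gt0)//.
rewrite -[leRHS](@expR0 R) ler_expR oppr_le0 divr_ge0// mulr_ge0 ?sqr_ge0//.
exact: ltW.
Qed.

Lemma Lam_nP n x (r : R) z : 0 <= r -> Lam_n G n x r z <->
  vset G z /\ `|emb R z - sq n *: x| <= r * sq n.
Proof.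
move=> r0; have h : 0 <= r * sq n by rewrite mulr_ge0 ?sqrtr_ge0.
by split => -[Uz H]; split=> //; exact/cubeP.
Qed.

Definition Lam_list n x (r : R) : {fset 'rV[int]_d} := fset_set (Lam_n G n x r).

Lemma in_Lam_list n x (r : R) z : (z \in Lam_list n x r) = (z \in Lam_n G n x r).
Proof. by rewrite /Lam_list in_fset_set//; exact: finite_Lam. Qed.

Lemma vol_Lam n x (r : R) :
  vol G mu (Lam_n G n x r) = \sum_(z <- Lam_list n x r) vweight G mu z.
Proof.
rewrite /vol fsbig_finite//; exact: finite_Lam.
Qed.

Lemma vol_eventually q (r e : R) : 0 < r -> 0 < e ->
  exists N, forall n, (N <= n)%N -> (0 < n)%N /\
    `|vol G mu (Lam_n G n (qpt q) r) - aG * (2 * r) ^+ d * sq n ^+ d| <=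
      e * (2 * r) ^+ d * sq n ^+ d.
Proof.
move=> r0 e0; have [/(_ r r0) H _ _] := rational_points q.
have [N HN] := cvg_eventually H e0.
exists (maxn N 1) => n; rewrite geq_max => /andP[Nn n0]; split=> //.
have := HN n Nn; have sn : 0 < sq n by rewrite sqrtr_gt0 ltr0n.
have rd : 0 < (2 * r * sq n) ^+ d by rewrite exprn_gt0// !mulr_gt0.
rewrite (_ : 2 * sq n * r = 2 * r * sq n); last by ring.
rewrite -!mulrA -!exprMn_comm ?mulrA; try exact: mulrC.
rewrite -(ler_pM2r rd) -[X in _ * X <= _](gtr0_norm rd) -normrM mulrBl.
by rewrite divfK ?gt_eqF.
Qed.

Lemma point_in n (x : 'rV[R]_d) : vset G (point n x).
Proof. by have [] := closestP n x le_tot le_tr G0. Qed.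

(** Positive volume leaves a vertex within [r / 4] of [q] after rescaling; the closest vertex to [x]
    is then within [r / 2] of [x], hence within [3 r / 4] of [q]. *)
Lemma point_near q (r : R) : 0 < r -> exists N, forall n, (N <= n)%N ->
  (0 < n)%N /\ forall x, `|x - qpt q| <= r / 4 -> Lam_n G n (qpt q) r (point n x).
Proof.
move=> r0; have r40 : 0 < r / 4 by rewrite divr_gt0.
have a20 : 0 < aG / 2 by rewrite divr_gt0.
have [N HN] := vol_eventually q r40 a20.
exists N => n /HN[n0 /ler_normlP[H _]]; split=> // x xq.
have sn : 0 < sq n by rewrite sqrtr_gt0 ltr0n.
have [z /Lam_nP[|Uz zq]] : exists z, Lam_n G n (qpt q) (r / 4) z.
- apply: contrapT => nz; move: H; rewrite vol_Lam big_seq big1.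
    have Y : 0 < (2 * (r / 4)) ^+ d * sq n ^+ d.
      by rewrite mulr_gt0// exprn_gt0// mulr_gt0.
    by rewrite -!mulrA; set Z := _ * _ in Y *; nra.
  by move=> z; rewrite in_Lam_list inE => Lz; case: nz; exists z.
- exact: ltW.
have [Ug gmin] := closestP n x le_tot le_tr G0.
apply/Lam_nP; first exact: ltW.
split=> //; have sx y : `|sq n *: x - sq n *: y| = sq n * `|x - y|.
  by rewrite -scalerBr normrZ gtr0_norm.
have h1 := ler_distD (sq n *: x) (emb R (point n x)) (sq n *: qpt q).
have h2 := gmin z Uz.
have h3 := ler_distD (sq n *: qpt q) (emb R z) (sq n *: x).
have h4 : sq n * `|x - qpt q| <= sq n * (r / 4) by rewrite ler_pM2l.
rewrite (distrC (sq n *: qpt q)) in h3.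
rewrite sx in h1 h3.
apply: le_trans h1 _; apply: (@le_trans _ _ (sq n * (r / 4) * 3)); last first.
  by rewrite mulrC; have : 0 < r * sq n := mulr_gt0 r0 sn; lra.
have h5 := le_trans h2 h3.
have := lerD h5 h4; have := lerD zq h4.
rewrite (mulrC (r / 4)); move: (sq n * (r / 4)) => A.
by move: `|_| `|_| => B C; lra.
Qed.

(** Two vertices of the cube differ by at most [2 * r * sq n] in the maximum norm, whence the
    condition on [r]; the other branch of the maximum in (e) is eventually at most
    [lam / 2 * sq n]. *)
Lemma Lam_gdist_lt q (r lam : R) : 0 < r -> 0 < lam -> 2 * C1 * r < lam ->
  exists N, forall n, (N <= n)%N -> forall z z',
    Lam_n G n (qpt q) r z -> Lam_n G n (qpt q) r z' ->
    (gdist G z z')%:R < lam * sq n.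
Proof.
move=> r0 lam0 rlam; have [_ /(_ r r0)[N1 HN1] _] := rational_points q.
have lam20 : 0 < lam / 2 by rewrite divr_gt0.
have [N2 HN2] := powR_lt_sqrt delta_gt0 lam20.
exists (maxn (maxn N1 N2) 1) => n; rewrite !geq_max => /andP[/andP[n1 n2] n0] z z' Lz Lz'.
have sn : 0 < sq n by rewrite sqrtr_gt0 ltr0n.
have [_ /le_lt_trans] := HN1 n n1 z z' Lz Lz'; apply.
rewrite gt_max; apply/andP; split; last first.
  by apply: le_lt_trans (HN2 n n2) _; rewrite ltr_pM2r// ltr_pdivrMr// ltr_pMr// ltr1n.
case/Lam_nP: Lz => [|_ hz]; first exact: ltW.
case/Lam_nP: Lz' => [|_ hz']; first exact: ltW.
have := ler_distD (sq n *: qpt q) (emb R z) (emb R z').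
rewrite (distrC (sq n *: qpt q)) => h.
have {}h : `|emb R z - emb R z'| <= 2 * (r * sq n).
  by apply: le_trans h _; apply: le_trans (lerD hz hz') _; lra.
apply: (@le_lt_trans _ _ (2 * C1 * r * sq n)); last by rewrite ltr_pM2r.
by rewrite -!mulrA mulrCA ler_pM2l// mulrA; apply: le_trans h _; rewrite mulrA.
Qed.

Lemma s_eventually q (e : R) : 0 < e -> exists N, forall n, (N <= n)%N ->
  (0 < n)%N /\ s (point n (qpt q)) <= e * sq n.
Proof.
move=> e0; have [_ _ H] := rational_points q.
have [N HN] := cvg_eventually H e0.
exists (maxn N 1) => n; rewrite geq_max => /andP[Nn n0]; split=> //.
have := HN n Nn; have sn : 0 < sq n by rewrite sqrtr_gt0 ltr0n.
rewrite subr0 => /(le_trans (ler_norm _)).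
by rewrite mulrC ler_pdivrMr.
Qed.

(** * Smoothness of the heat kernel near a rational point *)

Let CH' := Num.max CH 1.

Let CH'_ge : CH <= CH'.
Proof. by rewrite /CH' le_max lexx. Qed.

Let CH'_ge1 : 1 <= CH'.
Proof. by rewrite /CH' le_max lexx orbT. Qed.

(** With [rho = 4 * eta * sq n], [tdensity_diag_le] covers the times from [4 eta^2 n] to [8 eta^2 n]
    and the half ball of radius [2 * eta * sq n]. For [r = eta / (2 * C1)] the cube lies in that
    half ball by (e), and its volume is of order [n^(d/2)]. *)
Lemma diag_eventually (eta : R) : 0 < eta -> exists2 C : R, 0 < C & forall q,
  exists N, forall n, (N <= n)%N -> forall y m, vset G y ->
    (gdist G (point n (qpt q)) y)%:R < 2 * eta * sq n ->
    4 * eta ^+ 2 * n%:R <= m%:R <= 8 * eta ^+ 2 * n%:R ->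
    p m y y <= C / sq n ^+ d.
Proof.
move=> eta0; pose r := eta / (2 * C1).
have r0 : 0 < r by rewrite divr_gt0// mulr_gt0.
have rd : 0 < (2 * r) ^+ d by rewrite exprn_gt0// mulr_gt0.
have a20 : 0 < aG / 2 by rewrite divr_gt0.
have CH'0 : 0 < CH' by rewrite (lt_le_trans _ CH'_ge1).
exists (2 * CH' / (aG / 2 * (2 * r) ^+ d)).
  by rewrite divr_gt0// mulr_gt0.
move=> q; have eta20 : 0 < 2 * eta by rewrite mulr_gt0.
have rlam : 2 * C1 * r < 2 * eta.
  rewrite /r (_ : _ * _ = eta); first by lra.
  by field; rewrite gt_eqF.
have [N1 H1] := Lam_gdist_lt q r0 eta20 rlam.
have [N2 H2] := vol_eventually q r0 a20.
have [N3 H3] := point_near q r0.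
have [N4 H4] := s_eventually q (mulr_gt0 (ltr0n R 4) eta0).
have [N5 H5] := sqrt_eventually_ge eta^-1.
exists (maxn (maxn (maxn N1 N2) (maxn N3 N4)) N5) => n.
rewrite !geq_max => /andP[/andP[/andP[n1 n2] /andP[n3 n4]] n5] y m Uy xy mn.
have {H1} := H1 n n1; have {H2}[n0 /ler_normlP[vol2 _]] := H2 n n2.
have {H3}[_ H3] := H3 n n3; have {H4}[_ H4] := H4 n n4; have {H5} H5 := H5 n n5.
move=> H1; set x0 := point n (qpt q) in H4 xy *.
have Ux0 : vset G x0 by exact: point_in.
have sn : 0 < sq n by rewrite sqrtr_gt0 ltr0n.
pose rho := 4 * eta * sq n.
have es1 : 1 <= eta * sq n by rewrite -ler_pdivrMl// mulr1.
have rho4 : 4 <= rho by rewrite /rho -mulrA; lra.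
have rhoE : rho ^+ 2 = 16 * eta ^+ 2 * n%:R.
  by rewrite !exprMn sqr_sqrtr// -natrX.
have Lx0 : Lam_n G n (qpt q) r x0.
  by apply: H3; rewrite subrr normr0 divr_ge0// ltW.
have rho2 : rho / 2 = 2 * eta * sq n by rewrite /rho; field.
have diag := @tdensity_diag_le R d G CM mu cond G_inf G_conn disp Omega P X chain
  CH CH' x0 rho y m (Lam_list n (qpt q) r) CH_gt0 CH'_ge Ux0 (phi Ux0 H4).
have {diag} : p m y y * vol G mu (Lam_n G n (qpt q) r) <= 2 * CH'.
  rewrite vol_Lam; apply: diag => //.
  - by lra.
  - by rewrite (_ : 16 = 4 ^+ 2) ?ler_pXn2r ?nnegrE -?natrX//; lra.
  - by rewrite rho2.
  - move=> z; rewrite in_Lam_list inE => Lz; split; first by case: Lz.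
    by rewrite rho2; exact: H1.
  - by rewrite rhoE; move: mn => /andP[? ?]; apply/andP; split; lra.
have snd : 0 < sq n ^+ d by rewrite exprn_gt0.
have volge : aG / 2 * (2 * r) ^+ d * sq n ^+ d <= vol G mu (Lam_n G n (qpt q) r).
  by move: vol2; rewrite -!mulrA; set Z := _ * (_ ^+ d); lra.
move=> /(le_trans (ler_wpM2l (p_ge0 m Uy Uy) volge)) H.
by rewrite ler_pdivlMr// ler_pdivlMr ?mulr_gt0// -mulrA (mulrC (sq n ^+ d)).
Qed.

Lemma time_regularity_eventually (eta eps : R) q : 0 < eta -> 24 * eta ^+ 2 <= T1 ->
  0 < eps -> exists N, forall n, (N <= n)%N -> forall y m, vset G y ->
    (gdist G (point n (qpt q)) y)%:R < 2 * eta * sq n ->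
    T1 / 2 * n%:R <= m%:R -> `|p m 0 y - p m.+2 0 y| <= eps / sq n ^+ d.
Proof.
move=> eta0 etaT eps0; have [C C0 /(_ q)[N1 H1]] := diag_eventually eta0.
pose M := C2 * (T1 / 4) `^ (- (d%:R / 2)).
have M0 : 0 <= M by rewrite mulr_ge0 ?powR_ge0// ltW.
have T14 : 0 < T1 / 4 by rewrite divr_gt0.
have [N2 H2] := nat_eventually_ge (C3 / (T1 / 4)).
have [N3 H3] := nat_eventually_ge (eta ^- 2).
have [N4 H4] := sqrt_eventually_ge ((16 * M / T1 + C) / eps).
exists (maxn (maxn (maxn N1 N2) (maxn N3 N4)) 1) => n.
rewrite !geq_max => /andP[/andP[/andP[n1 n2] /andP[n3 n4]] n0] y m Uy xy mn.
have {}H1 := H1 n n1 y _ Uy xy; have {}H2 := H2 n n2.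
have {}H3 := H3 n n3; have {}H4 := H4 n n4.
have nR : 0 < n%:R :> R by rewrite ltr0n.
have sn : 0 < sq n by rewrite sqrtr_gt0.
have snd : 0 < sq n ^+ d by rewrite exprn_gt0.
pose E := eta ^+ 2 * n%:R.
have E1 : 1 <= E.
  by rewrite /E -ler_pdivrMl ?exprn_gt0// mulr1.
have ET : 24 * E <= T1 * n%:R by rewrite /E mulrA ler_pM2r.
have C3n : C3 <= T1 / 4 * n%:R by rewrite mulrC -ler_pdivrMr.
(* [b] steps go to the end point [y], with [2 b] in the range of [diag_eventually]; [l] is the
   length of the averaging; [24 * E <= T1 * n] leaves at least [T1 / 4 * n] steps for [i], where (b)
   applies. *)
pose b := Num.truncn (3 * E); pose l := Num.truncn (T1 / 8 * n%:R).
have [bl bu] : b%:R <= 3 * E /\ 3 * E < b%:R + 1.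
  have /andP[? ?] : b%:R <= 3 * E < b.+1%:R by apply: truncn_itv; lra.
  by split=> //; rewrite natr1.
have [ll lu] : l%:R <= T1 / 8 * n%:R /\ T1 / 8 * n%:R < l.+1%:R.
  have /andP[? ?] : l%:R <= T1 / 8 * n%:R < l.+1%:R by apply: truncn_itv; lra.
  by [].
have T1n : 0 < T1 * n%:R by rewrite mulr_gt0.
have blm : (b + l <= m)%N by rewrite -(ler_nat R) natrD; lra.
pose i := (m - (b + l))%N.
have iE : i%:R = m%:R - b%:R - l%:R :> R by rewrite /i natrB// natrD; ring.
have mE : (i + l + b = m)%N by rewrite /i -addnA (addnC l) subnK.
have diag0 j : T1 / 4 * n%:R <= j%:R -> p j 0 0 <= M / sq n ^+ d.
  move=> jn; apply: le_trans (hat_le T14 n0 jn (le_trans C3n jn) G0).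
  by rewrite lerDl p_ge0.
have dbl j : (j.*2)%:R = 2 * j%:R :> R by rewrite -mul2n natrM.
have bi : p i.*2 0 0 <= M / sq n ^+ d by apply: diag0; rewrite dbl; lra.
have bil : p (i + l).+2.*2 0 0 <= M / sq n ^+ d.
  have E2 : (i + l).+2%:R = i%:R + l%:R + 2 :> R by rewrite -addn2 !natrD.
  have l0 : 0 <= l%:R :> R by [].
  by apply: diag0; rewrite dbl E2 iE; lra.
have by_ : p b.*2 y y <= C / sq n ^+ d.
  apply: H1; rewrite dbl -[4 * _ * _]mulrA -[8 * _ * _]mulrA -/E.
  by apply/andP; split; lra.
(* The weight [sq n] balances the two terms: both become of order [n^(-1/2) n^(-d/2)]. *)
have TR := tdensity_time_regularity (cond_sym cond) (cond_ge0 cond) (cond_fin cond)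
  (vweight_gt0 cond G_inf G_conn) i l b sn G0 Uy.
rewrite mE in TR.
suff bound : sq n * ((p i.*2 0 0 + p (i + l).+2.*2 0 0) / l.+1%:R) +
    (sq n)^-1 * p b.*2 y y <= eps / sq n ^+ d.
  have := le_trans TR bound; have : 0 <= `|p m 0 y - p m.+2 0 y| by [].
  lra.
have nsq : n%:R = sq n * sq n :> R by rewrite -expr2 sqr_sqrtr// ltW.
apply: (@le_trans _ _ (sq n * ((2 * (M / sq n ^+ d)) / (T1 / 8 * n%:R)) +
    (sq n)^-1 * (C / sq n ^+ d))).
  apply: lerD; last by rewrite ler_pM2l ?invr_gt0.
  rewrite ler_pM2l//; apply: ler_pM.
  - by rewrite addr_ge0// p_ge0.
  - by rewrite invr_ge0.
  - by lra.
  - by rewrite lef_pV2 ?posrE ?ltr0n//; [exact: ltW|rewrite mulr_gt0// divr_gt0].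
rewrite [T1 / 8 * _](congr1 _ nsq) [leLHS](_ : _ = (16 * M / T1 + C) / sq n / sq n ^+ d); last first.
  by field; rewrite !gt_eqF.
by rewrite ler_pM2r ?invr_gt0// ler_pdivrMr// -ler_pdivrMl// mulrC.
Qed.

Lemma hat_caloric : globally_caloric G mu hat.
Proof.
have c0 := tdensity_caloric cond G_inf G_conn 0.
exact: (globally_caloricD cond c0 (globally_caloric_shift 1 c0)).
Qed.

Lemma geometric_eventually (q0 M e : R) : 0 <= q0 < 1 -> 0 < e ->
  exists K : nat, q0 ^+ K * M <= e.
Proof.
move=> /andP[q00 q01] e0.
have cv : q0 ^+ K * M @[K --> \oo] --> (0 : R).
  rewrite -(mul0r M); apply: cvgMl; apply: cvg_expr; rewrite ger0_norm//.
have [N HN] := cvg_eventually cv e0; exists N.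
by have := HN N (leqnn N); rewrite subr0; apply: le_trans; exact: ler_norm.
Qed.

(** [K] makes the geometric factor small, and [eps] then makes [K] additive errors small. Both, and
    hence [lam], are fixed before [q], which affects only the threshold; the covering argument rests
    on this uniformity. *)
Lemma oscillation_eventually (k0 : R) : 0 < k0 -> exists2 lam : R, 0 < lam &
  forall q, exists N, forall n, (N <= n)%N -> forall k z z',
    T1 * n%:R - 1 <= k%:R -> vset G z -> vset G z' ->
    (gdist G (point n (qpt q)) z)%:R < lam * sq n ->
    (gdist G (point n (qpt q)) z')%:R < lam * sq n ->
    `|hat k z - hat k z'| <= k0 / sq n ^+ d.
Proof.
(* The largest [eta] that [time_regularity_eventually] allows; the window [rho ^+ 2 = T1 * n / 24]
   keeps the times around [k] above [T1 / 2 * n]. *)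
move=> k00; pose eta := Num.sqrt (T1 / 24).
have T124 : 0 < T1 / 24 by rewrite divr_gt0.
have eta0 : 0 < eta by rewrite sqrtr_gt0.
have eta2 : eta ^+ 2 = T1 / 24 by rewrite sqr_sqrtr// ltW.
have etaT : 24 * eta ^+ 2 <= T1 by rewrite eta2; lra.
have T12 : 0 < T1 / 2 by rewrite divr_gt0.
pose M := C2 * (T1 / 2) `^ (- (d%:R / 2)).
pose g := (2 * CH')^-1.
(* Raising the Harnack constant to at least 1 makes the contraction factor nonnegative. *)
have g01 : 0 <= 1 - g < 1.
  have CH'0 : 0 < CH' by rewrite (lt_le_trans _ CH'_ge1).
  have h0 : 0 < g by rewrite invr_gt0 mulr_gt0.
  have h1 : g <= 1 by rewrite invf_le1 ?mulr_gt0//; have := CH'_ge1; lra.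
  by apply/andP; split; lra.
have k20 : 0 < k0 / 2 by rewrite divr_gt0.
have [K HK] := geometric_eventually M g01 k20.
(* The successor avoids a division by 0, as [K] may be 0. *)
pose eps := k0 / 2 / K.+1%:R.
have eps0 : 0 < eps by rewrite divr_gt0.
have K8 : 0 < 8 ^+ K :> R by rewrite exprn_gt0.
exists (2 * (eta / 8 ^+ K)); first by rewrite mulr_gt0// divr_gt0.
move=> q; have [N1 H1] := time_regularity_eventually q eta0 etaT eps0.
have [N2 H2] := s_eventually q (divr_gt0 eta0 K8).
have [N3 H3] := sqrt_eventually_ge (4 / (eta / 8 ^+ K)).
have [N4 H4] := nat_eventually_ge (4 / T1).
have [N5 H5] := nat_eventually_ge (C3 / (T1 / 2)).
exists (maxn (maxn (maxn N1 N2) (maxn N3 N4)) N5) => n.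
rewrite !geq_max => /andP[/andP[/andP[n1 n2] /andP[n3 n4]] n5] k z z' kn Uz Uz' xz xz'.
have {}H1 := H1 n n1; have {H2}[n0 H2] := H2 n n2.
have {}H3 := H3 n n3; have {}H4 := H4 n n4; have {}H5 := H5 n n5.
set x0 := point n (qpt q) in H1 H2 xz xz'.
have Ux0 : vset G x0 by exact: point_in.
have nR : 0 < n%:R :> R by rewrite ltr0n.
have sn : 0 < sq n by rewrite sqrtr_gt0.
have snd : 0 < sq n ^+ d by rewrite exprn_gt0.
have T1n : 4 <= T1 * n%:R by rewrite mulrC -ler_pdivrMr.
pose rho := eta * sq n.
have rhoE : rho ^+ 2 = T1 * n%:R / 24.
  by rewrite exprMn eta2 sqr_sqrtr ?ltW//; field.
have win m : `|m%:R - k%:R| <= rho ^+ 2 -> T1 / 2 * n%:R <= m%:R.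
  rewrite rhoE ler_norml => /andP[h _]; lra.
have HR := @oscillation_decay R d G CM mu cond G_conn CH CH' x0 (s x0) rho hat k K
  (M / sq n ^+ d) (eps / sq n ^+ d) CH_gt0 CH'_ge CH'_ge1 Ux0.
have rhoK : rho / 8 ^+ K = eta / 8 ^+ K * sq n by rewrite /rho mulrAC.
apply: (@le_trans _ _ ((1 - (2 * CH')^-1) ^+ K * (M / sq n ^+ d) +
    K%:R * (eps / sq n ^+ d))).
  apply: HR.
  - by move=> r sr; exact: phi.
  - exact: hat_caloric.
  - by rewrite rhoK.
  - by rewrite rhoK mulrC -ler_pdivrMr ?divr_gt0.
  - by rewrite rhoE; lra.
  - move=> m y Uy xy mk; rewrite hat_ge0//=; apply: hat_le => //; first exact: win.
    by apply: le_trans (win m mk); rewrite mulrC -ler_pdivrMr.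
  (* The first time difference of [hat] is a lag-two difference of the density, which is what the
     l^2 argument controls. *)
  - move=> m y Uy xy mk; rewrite distrC.
    rewrite (_ : _ - _ = p m 0 y - p m.+2 0 y); last by rewrite /hat; ring.
    by apply: H1 => //; [rewrite -mulrA|exact: win].
  - by [].
  - by [].
  - by rewrite rhoK mulrA.
  - by rewrite rhoK mulrA.
have Keps : K%:R * eps <= k0 / 2.
  rewrite /eps mulrCA ler_piMr// ?(ltW k20)// ler_pdivrMr ?ltr0Sn// mul1r.
  by rewrite ler_nat.
have -> : (1 - (2 * CH')^-1) ^+ K * (M / sq n ^+ d) + K%:R * (eps / sq n ^+ d) =
    ((1 - g) ^+ K * M + K%:R * eps) / sq n ^+ d.
  by rewrite -/g; move: ((1 - g) ^+ K) (sq n ^+ d)^-1 => A B; ring.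
rewrite ler_pM2r ?invr_gt0//.
apply: le_trans (lerD HK Keps) _; lra.
Qed.

(** * From the central limit theorem to values at the closest vertex *)

Lemma uniform_eventually (I : set R) (F : nat -> R -> R) (f : R -> R) (e : R) :
  {uniform I, F @ \oo --> f} -> 0 < e ->
  exists N, forall n, (N <= n)%N -> forall t, I t -> `|F n t - f t| <= e.
Proof.
move=> Ff e0.
have nb : nbhs (f : {uniform` I -> R}) [set h | forall t, I t -> `|h t - f t| <= e].
  apply/uniform_nbhs; exists [set ab | ball ab.1 e ab.2]; split.
    by rewrite -entourage_ballE; exists e.
  by move=> h /= H t It; rewrite distrC ltW//; exact: H.
have [N _ HN] := Ff _ nb.
by exists N => n Nn; exact: HN.
Qed.

Lemma clt_sum n (t : R) (y : 'rV[R]_d) (r : R) : (0 < n)%N -> 0 <= r ->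
  fine (P 0 [set w | cube y r (rescaled X n t w)]) =
  \sum_(z <- Lam_list n y r)
    vweight G mu z * p (Num.truncn (n%:R * t)) 0 z.
Proof.
move=> n0 r0; have sn : 0 < sq n by rewrite sqrtr_gt0 ltr0n.
set k := Num.truncn _.
transitivity (fine (P 0 (setT `&` [set w | X k w \in Lam_list n y r]))).
  have key z : `|(sq n)^-1 *: emb R z - y| = (sq n)^-1 * `|emb R z - sq n *: y|.
    rewrite -{2}(gtr0_norm (_ : 0 < (sq n)^-1)) ?invr_gt0// -normrZ scalerBr scalerA.
    by rewrite mulVf ?gt_eqF// scale1r.
  have keyP z : `|(sq n)^-1 *: emb R z - y| <= r = (`|emb R z - sq n *: y| <= r * sq n).
    by rewrite key mulrC ler_pdivrMr.
  congr (fine (P 0 _)); rewrite setTI; apply/seteqP; split => w /=.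
    rewrite in_Lam_list inE Lam_nP// cubeP// /rescaled -/k keyP => H.
    by split=> //; exact: chain_state chain _ _.
  by rewrite in_Lam_list inE Lam_nP// cubeP// /rescaled -/k keyP => -[].
rewrite (prob_fset chain)//.
rewrite big_seq_cond [RHS]big_seq_cond; apply: eq_bigr => z /andP[].
rewrite in_Lam_list inE => -[Uz _] _.
by rewrite setTI (prob_tdensity chain cond).
Qed.

(** Error budget: [S] is [n^(d/2)], [w] is [hat] at the closest vertex, [V] the volume of the cube,
    [sg] the sum of [hat] against [mu], and [c], [g] are the kernel at [q] and at [x]. After
    multiplication by [aG] the errors are 1/4 (volume), 1/4 (oscillation), 1/6 (limit of [sg]) and
    1/12 ([c - g]) of [aG * k0]. *)
Lemma cube_average_limit (W w c g th k1 k2 V S vol sg M k0 : R) :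
  0 < V -> 0 < S -> 0 <= w -> 0 < k0 -> 0 <= M ->
  W = S * w -> W <= M -> k1 = k0 / 8 -> k2 = aG * k0 / 24 ->
  th <= aG -> th * (4 * (M + 1)) <= aG * k0 -> 0 <= th ->
  `|vol - aG * V * S| <= th * V * S ->
  `|sg - vol * w| <= vol * (k1 / S) ->
  `|sg - 2 * c * V| <= 4 * k2 * V ->
  `|c - g| <= k2 ->
  `|W - 2 * aG^-1 * g| <= k0.
Proof.
move=> V0 S0 w0 k00 M0 WE WM k1E k2E tha thM th0 h1 h2 h3 h4.
have W0 : 0 <= W by rewrite WE mulr_ge0// ltW.
have VS : 0 < V * S by rewrite mulr_gt0.
have a1 : `|vol * w - aG * V * W| <= th * V * M.
  have -> : vol * w - aG * V * W = (vol - aG * V * S) * w by rewrite WE; ring.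
  rewrite normrM (ger0_norm w0); apply: le_trans (ler_wpM2r w0 h1) _.
  have -> : th * V * S * w = th * V * W by rewrite WE; ring.
  by apply: ler_wpM2l => //; rewrite mulr_ge0// ltW.
have a2 : vol * (k1 / S) <= aG * V * k0 / 4.
  have volle : vol <= 2 * aG * (V * S).
    move: h1 => /ler_normlP[_]; have : th * (V * S) <= aG * (V * S) by rewrite ler_pM2r.
    by rewrite !mulrA; lra.
  have kS : 0 <= k1 / S by rewrite k1E !divr_ge0 ?ltW.
  apply: le_trans (ler_wpM2r kS volle) _; rewrite k1E.
  by rewrite le_eqVlt; apply/orP; left; apply/eqP; field; rewrite gt_eqF.
have a3 : `|aG * V * W - 2 * c * V| <= th * V * M + aG * V * k0 / 4 + 4 * k2 * V.
  have -> : aG * V * W - 2 * c * V =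
    - (vol * w - aG * V * W) + (- (sg - vol * w) + (sg - 2 * c * V)) by ring.
  apply: le_trans (ler_normD _ _) _; rewrite -addrA normrN; apply: lerD => //.
  apply: le_trans (ler_normD _ _) _; rewrite normrN; apply: lerD => //.
  exact: le_trans h2 a2.
have a4 : `|aG * W - 2 * c| <= th * M + aG * k0 / 4 + 4 * k2.
  rewrite -(ler_pM2r V0) -{1}(gtr0_norm V0) -normrM.
  have -> : (aG * W - 2 * c) * V = aG * V * W - 2 * c * V by ring.
  by apply: le_trans a3 _; lra.
rewrite -(ler_pM2l aG_gt0) -{1}(gtr0_norm aG_gt0) -normrM.
have -> : aG * (W - 2 * aG^-1 * g) = (aG * W - 2 * c) + 2 * (c - g).
  by field; rewrite gt_eqF.
apply: le_trans (ler_normD _ _) _; rewrite (normrM 2) ger0_norm//.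
have : 0 <= aG * k0 by rewrite mulr_ge0// ltW.
have : th * M <= aG * k0 / 4 by lra.
by move: a4 h4; rewrite k2E; move: `|_| `|_| => A B; lra.
Qed.

Lemma compact_eventually_near_rational (k0 K T2 : R) : 0 < k0 -> 0 <= K -> T1 <= T2 ->
  exists2 r, 0 < r & forall q, `|qpt q| <= K ->
    exists N, forall n, (N <= n)%N -> forall x t, `|x - qpt q| <= r ->
      T1 <= t <= T2 ->
      `|sq n ^+ d * hat (Num.truncn (n%:R * t)) (point n x)
        - 2 * aG^-1 * gauss D t x| <= k0.
Proof.
move=> k00 K0 T12; pose M := C2 * (T1 / 2) `^ (- (d%:R / 2)).
have M0 : 0 <= M by rewrite mulr_ge0 ?powR_ge0// ltW.
have T120 : 0 < T1 / 2 by rewrite divr_gt0.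
pose k1 := k0 / 8; pose k2 := aG * k0 / 24.
have k10 : 0 < k1 by rewrite divr_gt0.
have k20 : 0 < k2 by rewrite divr_gt0// mulr_gt0.
pose th := Num.min aG (aG * k0 / (4 * (M + 1))).
have M1 : 0 < 4 * (M + 1) by lra.
have th0 : 0 < th by rewrite lt_min aG_gt0 divr_gt0// mulr_gt0.
have tha : th <= aG by rewrite /th ge_min lexx.
have thM : th * (4 * (M + 1)) <= aG * k0.
  by rewrite -ler_pdivlMr// /th ge_min lexx orbT.
have [lam lam0 osc] := oscillation_eventually k10.
have [r0 r00 modul] := gauss_modulus d D_gt0 T1_gt0 K0 k20.
(* Two demands on the cube: the Gauss kernel varies by at most [k2] on it, and its vertices are
   within [lam * sq n] of the closest vertex to [q], where [hat] is nearly constant. *)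
pose rho := Num.min r0 (lam / (4 * C1)).
have rho0 : 0 < rho by rewrite lt_min r00 divr_gt0// mulr_gt0.
have rhor : rho <= r0 by rewrite /rho ge_min lexx.
have rhol : 2 * C1 * rho < lam.
  have : rho <= lam / (4 * C1) by rewrite /rho ge_min lexx orbT.
  rewrite ler_pdivlMr ?mulr_gt0// => h.
  by rewrite (_ : 2 * C1 * rho = (rho * (4 * C1)) / 2); [lra|field].
pose V := (2 * rho) ^+ d.
have V0 : 0 < V by rewrite exprn_gt0// mulr_gt0.
exists (rho / 4); first by rewrite divr_gt0.
move=> q qK.
have [N1 H1] := osc q; have [N2 H2] := vol_eventually q rho0 th0.
have [N3 H3] := point_near q rho0; have [N4 H4] := Lam_gdist_lt q rho0 lam0 rhol.
have [N5 H5] := nat_eventually_ge r0^-1.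
have [N6 H6] := nat_eventually_ge (4 / T1).
have [N7 H7] := nat_eventually_ge (C3 / (T1 / 2)).
have cltI : [set t | T1 <= t <= T2 + 1] `<=` [set t : R | 0 < t].
  by move=> t /= /andP[h _]; exact: lt_le_trans h.
have cI : compact [set t | T1 <= t <= T2 + 1].
  rewrite (_ : [set _ | _] = `[T1, T2 + 1]%classic); first exact: segment_compact.
  by apply/seteqP; split => t /=; rewrite in_itv.
have [N8 H8] := uniform_eventually (clt (y := qpt q) cI cltI rho0) (mulr_gt0 k20 V0).
exists (maxn (maxn (maxn N1 N2) (maxn N3 N4)) (maxn (maxn N5 N6) (maxn N7 N8))) => n.
rewrite !geq_max => /andP[/andP[/andP[n1 n2] /andP[n3 n4]]
  /andP[/andP[n5 n6] /andP[n7 n8]]] x t xq /andP[t1 t2].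
have {}H1 := H1 n n1; have {H2}[n0 H2] := H2 n n2; have {H3}[_ H3] := H3 n n3.
have {}H4 := H4 n n4; have {}H5 := H5 n n5; have {}H6 := H6 n n6.
have {}H7 := H7 n n7; have {}H8 := H8 n n8.
have nR : 0 < n%:R :> R by rewrite ltr0n.
have sn : 0 < sq n by rewrite sqrtr_gt0.
have snd : 0 < sq n ^+ d by rewrite exprn_gt0.
set k := Num.truncn (n%:R * t); set gx := point n x.
have t0 : 0 < t := lt_le_trans T1_gt0 t1.
have [kl ku] : k%:R <= n%:R * t /\ n%:R * t < k%:R + 1.
  have /andP[? ?] : k%:R <= n%:R * t < k.+1%:R.
    by apply: truncn_itv; rewrite mulr_ge0// ltW.
  by split=> //; rewrite natr1.
have nT1 : 4 <= T1 * n%:R by rewrite mulrC -ler_pdivrMr.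
have nt1 : T1 * n%:R <= n%:R * t by rewrite mulrC ler_pM2l.
have kT : T1 * n%:R - 1 <= k%:R by lra.
have C3k : C3 <= k%:R.
  have : C3 <= T1 / 2 * n%:R by rewrite mulrC -ler_pdivrMr.
  lra.
have Ugx : vset G gx by exact: point_in.
(* [t'] is one step of the chain later, so the two terms of [hat] come from the limit theorem at [t]
   and at [t']; hence the compact time interval up to [T2 + 1]. *)
pose t' := t + n%:R^-1.
have tt' : `|t' - t| <= r0.
  rewrite /t' addrAC subrr add0r gtr0_norm ?invr_gt0//.
  by rewrite -[leRHS]invrK lef_pV2 ?posrE ?invr_gt0.
have t't : t <= t' by rewrite lerDl invr_ge0 ltW.
have n1' : n%:R^-1 <= 1 :> R by rewrite invf_le1// ler1n.
have kS : Num.truncn (n%:R * t') = k.+1.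
  rewrite mulrDr mulfV ?gt_eqF//; apply: truncn_def.
  by rewrite -natr1 -[k.+2%:R]natr1 -natr1; apply/andP; split; lra.
pose L := Lam_list n (qpt q) rho.
pose sg := \sum_(z <- L) vweight G mu z * hat k z.
have cubeE u : T1 <= u -> `|u - t| <= r0 ->
    `|integral_cube (qpt q) rho (gauss D u) - gauss D t (qpt q) * V| <= k2 * V.
  move=> Tu ut; apply: integral_cube_approx; first exact: ltW.
    exact: measurable_gauss.
  move=> v /cubeP; move=> /(_ (ltW rho0)) vq; apply: modul => //.
  exact: le_trans vq rhor.
(* Each of the two times costs [k2 * V] for the limit theorem and [k2 * V] for replacing the kernel
   by its value at [t] and [q]. *)
have sgE : `|sg - 2 * gauss D t (qpt q) * V| <= 4 * k2 * V.
  have -> : sg = fine (P 0 [set w | cube (qpt q) rho (rescaled X n t w)]) +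
      fine (P 0 [set w | cube (qpt q) rho (rescaled X n t' w)]).
    rewrite !clt_sum ?(ltW rho0)// kS -big_split/=.
    by apply: eq_bigr => z _; rewrite /hat mulrDr.
  have It : T1 <= t <= T2 + 1 by apply/andP; split=> //; lra.
  have It' : T1 <= t' <= T2 + 1.
    by apply/andP; split; [exact: le_trans t1 t't|rewrite lerD].
  have b1 := H8 t It; have b2 := H8 t' It'.
  have T1t' : T1 <= t' := le_trans t1 t't.
  have tt0 : `|t - t| <= r0 by rewrite subrr normr0 ltW.
  have b3 := cubeE t t1 tt0; have b4 := cubeE t' T1t' tt'.
  move: b1 b2 b3 b4; rewrite !ler_norml.
  move=> /andP[? ?] /andP[? ?] /andP[? ?] /andP[? ?]; apply/andP; split; lra.
have Lgx : Lam_n G n (qpt q) rho gx by exact: H3.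
have Lx0 : Lam_n G n (qpt q) rho (point n (qpt q)).
  by apply: H3; rewrite subrr normr0 divr_ge0// ltW.
have sgV : `|sg - vol G mu (Lam_n G n (qpt q) rho) * hat k gx| <=
    vol G mu (Lam_n G n (qpt q) rho) * (k1 / sq n ^+ d).
  rewrite vol_Lam !mulr_suml -sumrB; apply: le_trans (ler_norm_sum _ _ _) _.
  rewrite big_seq_cond [leRHS]big_seq_cond; apply: ler_sum => z /andP[].
  rewrite in_Lam_list inE => Lz _; rewrite -mulrBr normrM.
  have wz : 0 < vweight G mu z.
    by apply: (vweight_gt0 cond G_inf G_conn); case: Lz.
  rewrite gtr0_norm// ler_pM2l//; apply: H1 => //; first by case: Lz.
  - exact: H4.
  - exact: H4.
apply: (@cube_average_limit _ (hat k gx) (gauss D t (qpt q)) _ th k1 k2 V (sq n ^+ d)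
  (vol G mu (Lam_n G n (qpt q) rho)) sg M) => //.
- exact: hat_ge0.
- rewrite mulrC -ler_pdivlMr//; apply: hat_le => //.
  by lra.
- exact: ltW.
- rewrite distrC; apply: modul => //; first by rewrite subrr normr0 ltW.
  by apply: le_trans xq (le_trans _ rhor); rewrite ler_pdivrMr// ler_peMr ?ler1n// ltW.
Qed.

(** * Tails for large times and for distant points *)

Lemma powR_neg_half_le (a : R) : 1 <= a -> a `^ (- (d%:R / 2)) <= a^-1.
Proof.
move=> a1; rewrite -[leRHS]powR_inv1 ?(le_trans _ a1)//; apply: ler_powR => //.
(* [2 <= d] enters here: the exponent [d / 2] is at least 1. *)
by rewrite lerN2 ler_pdivlMr// mul1r ler_nat.
Qed.

Lemma time_tail (k0 : R) : 0 < k0 -> exists2 T2, T1 <= T2 &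
  exists N, forall n, (N <= n)%N -> forall x t, T2 <= t ->
    sq n ^+ d * hat (Num.truncn (n%:R * t)) (point n (x : 'rV[R]_d)) <= k0 /\
    2 * aG^-1 * gauss D t x <= k0.
Proof.
move=> k00; have pi0 := pi_gt0 R.
pose a := 2 * pi * D; have a0 : 0 < a by rewrite !mulr_gt0.
(* One summand per requirement: [T1 <= T2], [1 <= T2 / 2], smallness of the density, [1 <= a * t],
   smallness of the Gauss kernel. *)
pose T2 := T1 + 2 + 2 * C2 / k0 + a^-1 + 2 * aG^-1 / k0 / a.
have b1 : 0 <= 2 * C2 / k0 by rewrite divr_ge0 ?mulr_ge0// ltW.
have b2 : 0 <= a^-1 by rewrite invr_ge0 ltW.
have b3 : 0 <= 2 * aG^-1 / k0 / a.
  by rewrite !divr_ge0 ?mulr_ge0 ?invr_ge0// ltW.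
have T1' := ltW T1_gt0.
exists T2; first by rewrite /T2; lra.
have T22 : 2 <= T2 by rewrite /T2; lra.
have [N1 H1] := nat_eventually_ge C3.
exists (maxn N1 1) => n; rewrite geq_max => /andP[/H1 C3n n0] x t tT2.
have nR : 0 < n%:R :> R by rewrite ltr0n.
have n1 : 1 <= n%:R :> R by rewrite ler1n.
have snd : 0 < sq n ^+ d by rewrite exprn_gt0// sqrtr_gt0.
split.
  set k := Num.truncn _.
  have ku : n%:R * t < k%:R + 1 by rewrite natr1 truncnS_gt.
  have nt : n%:R * T2 <= n%:R * t by rewrite ler_pM2l.
  have n2 : n%:R * 2 <= n%:R * T2 by rewrite ler_pM2l.
  rewrite mulrC -ler_pdivlMr//.
  have c0 : 0 < T2 / 2 by lra.
  have ck : T2 / 2 * n%:R <= k%:R by lra.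
  have C3k : C3 <= k%:R by lra.
  apply: le_trans (hat_le c0 n0 ck C3k (point_in n x)) _.
  rewrite ler_pM2r ?invr_gt0//.
  have T21 : 1 <= T2 / 2 by lra.
  apply: le_trans (ler_wpM2l (ltW C2_gt0) (powR_neg_half_le T21)) _.
  rewrite ler_pdivrMr// -ler_pdivrMl// mulrC.
  have : 2 * C2 / k0 <= T2 by rewrite /T2; lra.
  by rewrite -mulrA; lra.
have t0 : 0 < t by lra.
have at1 : 1 <= 2 * pi * t * D.
  have -> : 2 * pi * t * D = a * t by rewrite /a; ring.
  by rewrite -ler_pdivrMl// mulr1; move: tT2; rewrite /T2; lra.
have -> : k0 = 2 * aG^-1 * (k0 / (2 * aG^-1)) by field; rewrite gt_eqF.
rewrite ler_pM2l ?mulr_gt0 ?invr_gt0//.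
rewrite /gauss; apply: (@le_trans _ _ ((2 * pi * t * D)^-1)).
  apply: le_trans (powR_neg_half_le at1); rewrite ler_piMr ?powR_ge0//.
  rewrite -[leRHS](@expR0 R) ler_expR oppr_le0 divr_ge0 ?sqr_ge0//.
  by rewrite !mulr_ge0// ltW.
have -> : 2 * pi * t * D = a * t by rewrite /a; ring.
have aG2 : 0 < 2 * aG^-1 by rewrite mulr_gt0// invr_gt0.
have kaG : 0 < k0 / (2 * aG^-1) by rewrite divr_gt0.
rewrite -[leRHS]invrK lef_pV2 ?posrE ?invr_gt0 ?(mulr_gt0 a0 t0)//.
rewrite invf_div -ler_pdivrMl// mulrC.
by move: tT2; rewrite /T2; lra.
Qed.

(** If the closest vertex to [y = sq n *: x] were farther than [|y| / 2], the cube of that radius at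
    [y] would be a hole, which (d) excludes for large [|y|]. As [|y| >= sq n] when [|x| >= 1], one
    threshold in [n] serves all [x]. *)
Lemma point_norm_ge : exists N, forall n, (N <= n)%N -> forall x : 'rV[R]_d,
  1 <= `|x| -> sq n * `|x| / 2 <= (gdist G 0 (point n x))%:R.
Proof.
have h12 : 0 < 1 / 2 :> R by lra.
have /cvgrPdist_lt/(_ (1 / 2) h12)[A [_ HA]] := small_holes.
have [N HN] := sqrt_eventually_ge (`|A| + 1).
exists (maxn N 1) => n; rewrite geq_max => /andP[/HN sA n0] x x1.
have sn : 0 < sq n by rewrite sqrtr_gt0 ltr0n.
set y := sq n *: x.
have yE : `|y| = sq n * `|x| by rewrite normrZ gtr0_norm.
have y0 : 0 < `|y| by rewrite yE mulr_gt0// (lt_le_trans _ x1).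
have yA : A < `|y|.
  apply: le_lt_trans (ler_norm A) _; apply: (@lt_le_trans _ _ (sq n)); first by lra.
  by rewrite yE ler_pMr.
have [Ug gmin] := closestP n x le_tot le_tr G0.
have gy : `|emb R (point n x) - y| <= `|y| / 2.
  rewrite leNgt; apply/negP => h.
  have := HA `|y| yA; rewrite sub0r normrN => /(le_lt_trans (ler_norm _)).
  apply/negP; rewrite -leNgt ler_pdivlMr//.
  apply: (@le_trans _ _ (`|y| / 2)); first by lra.
  apply: hole_ge => //.
  apply/seteqP; split => // z [Uz /cubeP].
  move=> /(_ (divr_ge0 (ltW y0) (ler0n _ _))) h2.
  by have := lt_le_trans h (le_trans (gmin z Uz) h2); rewrite ltxx.
have gE : `|emb R (point n x)| <= (gdist G 0 (point n x))%:R.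
  have := norm_emb_le_gdist R G_conn G0 (point_in n x).
  rewrite (_ : emb R 0 = 0) ?sub0r ?normrN//.
  by apply/rowP => i; rewrite !mxE.
apply: le_trans gE; rewrite -yE.
have := ler_distD (emb R (point n x)) y 0; rewrite !subr0 distrC.
by move: gy; move: `|_ - _| `|emb _ _| `|y| => a b c; lra.
Qed.

Lemma space_tail (k0 T2 : R) : 0 < k0 -> T1 <= T2 -> exists2 K, 0 <= K &
  exists N, forall n, (N <= n)%N -> forall x t, K <= `|x| -> T1 <= t <= T2 ->
    sq n ^+ d * hat (Num.truncn (n%:R * t)) (point n (x : 'rV[R]_d)) <= k0 /\
    2 * aG^-1 * gauss D t x <= k0.
Proof.
move=> k00 T12; have pi0 := pi_gt0 R.
have T20 : 0 < T2 := lt_le_trans T1_gt0 T12.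
pose M := C2 * (T1 / 2) `^ (- (d%:R / 2)).
have M0 : 0 <= M by rewrite mulr_ge0 ?powR_ge0// ltW.
pose B := 2 * aG^-1 * (2 * pi * T1 * D) `^ (- (d%:R / 2)).
have B0 : 0 <= B by rewrite mulr_ge0 ?powR_ge0// mulr_ge0// invr_ge0 ltW.
(* Both come from bounding [exp (- u)] by [1 / u], where [u] is at least a multiple of [|x| ^+ 2],
   hence of [|x|] as [|x| >= 1]. *)
pose K1 := M * (4 * T2 / C4) / k0; pose K2 := B * (2 * D * T2) / k0.
have K10 : 0 <= K1 by rewrite /K1 divr_ge0 ?(ltW k00)// mulr_ge0// divr_ge0// ?mulr_ge0// ltW.
have K20 : 0 <= K2 by rewrite /K2 divr_ge0 ?(ltW k00)// mulr_ge0// !mulr_ge0// ltW.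
pose K := 1 + K1 + K2.
exists K; first by rewrite /K; lra.
have [N1 H1] := point_norm_ge.
have [N2 H2] := nat_eventually_ge (4 / T1).
have [N3 H3] := nat_eventually_ge (C3 / (T1 / 2)).
exists (maxn (maxn N1 N2) (maxn N3 1)) => n.
rewrite !geq_max => /andP[/andP[/H1 {}H1 /H2 {}H2] /andP[/H3 {}H3 n0]] x t Kx /andP[t1 t2].
have nR : 0 < n%:R :> R by rewrite ltr0n.
have sn : 0 < sq n by rewrite sqrtr_gt0.
have snd : 0 < sq n ^+ d by rewrite exprn_gt0.
have x1 : 1 <= `|x| by apply: le_trans Kx; rewrite /K; lra.
have x0 : 0 < `|x| by apply: lt_le_trans x1.
have xx : `|x| <= `|x| ^+ 2 by rewrite expr2 ler_peMr// ltW.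
have t0 : 0 < t := lt_le_trans T1_gt0 t1.
split.
  set k := Num.truncn _; set g := point n x.
  have [kl ku] : k%:R <= n%:R * t /\ n%:R * t < k%:R + 1.
    have /andP[? ?] : k%:R <= n%:R * t < k.+1%:R.
      by apply: truncn_itv; rewrite mulr_ge0// ltW.
    by split=> //; rewrite natr1.
  have nT1 : 4 <= T1 * n%:R by rewrite mulrC -ler_pdivrMr.
  have nt1 : T1 * n%:R <= n%:R * t by rewrite mulrC ler_pM2l.
  have nt2 : n%:R * t <= n%:R * T2 by rewrite ler_pM2l.
  have T120 : 0 < T1 / 2 by rewrite divr_gt0.
  have ck : T1 / 2 * n%:R <= k%:R by lra.
  have C3k : C3 <= k%:R by apply: le_trans ck; rewrite mulrC -ler_pdivrMr.
  have k0' : 0 < k%:R :> R := lt_le_trans C3_gt0 C3k.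
  have Ug : vset G g := point_in n x.
  rewrite mulrC -ler_pdivlMr//.
  apply: le_trans (hat_gauss_bound T120 n0 ck C3k Ug) _.
  rewrite ler_pM2r ?invr_gt0// -/M.
  set u := C4 * _ / _.
  have gd := H1 x x1; have nsq : sq n * sq n = n%:R by rewrite -expr2 sqr_sqrtr// ltW.
  have u1 : `|x| * (C4 / (4 * T2)) <= u.
    rewrite /u ler_pdivlMr// (mulrC `|x|).
    have gd2 : n%:R * `|x| ^+ 2 / 4 <= (gdist G 0 g)%:R ^+ 2.
      have -> : n%:R * `|x| ^+ 2 / 4 = (sq n * `|x| / 2) ^+ 2.
        by rewrite -[n%:R in LHS]nsq; field.
      by rewrite ler_pXn2r ?nnegrE// divr_ge0// mulr_ge0// ltW.
    have CT : 0 <= C4 / (4 * T2) by rewrite divr_ge0 ?mulr_ge0// ltW.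
    apply: (@le_trans _ _ (C4 * (n%:R * `|x| ^+ 2 / 4))); last by rewrite ler_pM2l.
    apply: (@le_trans _ _ (C4 / (4 * T2) * `|x| ^+ 2 * (n%:R * T2))).
      apply: ler_pM; [by rewrite mulr_ge0|by []|exact: ler_wpM2l|].
      exact: le_trans kl nt2.
    by rewrite le_eqVlt; apply/orP; left; apply/eqP; field; rewrite gt_eqF.
  have CT : 0 < C4 / (4 * T2) by rewrite divr_gt0// mulr_gt0.
  have u0 : 0 < u by apply: lt_le_trans u1; rewrite mulr_gt0.
  apply: le_trans (ler_wpM2l M0 (expRN_le_inv u0)) _.
  rewrite ler_pdivrMr// mulrC -ler_pdivrMr//.
  apply: le_trans u1; rewrite -ler_pdivrMr//.
  apply: (@le_trans _ _ K1); last by apply: le_trans Kx; rewrite /K; lra.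
  by rewrite /K1 invf_div le_eqVlt mulrAC eqxx.
set S := l2norm x ^+ 2.
have xS : `|x| ^+ 2 <= S.
  rewrite ler_pXn2r ?nnegrE ?sqrtr_ge0//; apply: row_norm_le; first exact: sqrtr_ge0.
  move=> i; rewrite -sqrtr_sqr ler_wsqrtr// (bigD1 i)//= lerDl.
  by apply: sumr_ge0 => j _; rewrite sqr_ge0.
have S0 : 0 < S by apply: lt_le_trans xS; rewrite exprn_gt0.
have Dt : 0 < 2 * D * t by rewrite !mulr_gt0.
have SDt : 0 < S / (2 * D * t) by rewrite divr_gt0.
apply: (@le_trans _ _ (B * (2 * D * T2 / `|x|))).
  rewrite /gauss -/S mulrA /B; apply: ler_pM.
  - by rewrite mulr_ge0 ?powR_ge0// mulr_ge0// invr_ge0 ltW.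
  - exact: expR_ge0.
  - rewrite ler_pM2l ?mulr_gt0 ?invr_gt0// !powRN lef_pV2 ?posrE ?powR_gt0 ?mulr_gt0//.
    apply: ge0_ler_powR; rewrite ?nnegrE ?mulr_ge0 ?divr_ge0 ?(ltW pi0) ?(ltW D_gt0) ?(ltW t0) ?(ltW T1_gt0)//.
    by rewrite ler_pM2r// ler_pM2l ?mulr_gt0.
  - apply: le_trans (expRN_le_inv SDt) _; rewrite invf_div.
    apply: ler_pM; [exact: ltW|by rewrite invr_ge0 ltW| |].
      by rewrite ler_pM2l ?mulr_gt0.
    by rewrite lef_pV2 ?posrE//; exact: le_trans xx xS.
rewrite mulrA ler_pdivrMr// -ler_pdivrMl// mulrC -/K2.
by apply: le_trans Kx; rewrite /K; lra.
Qed.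

(** * Covering argument and uniform limit *)

Lemma rational_grid (r K : R) : 0 < r -> 0 <= K ->
  exists2 A : set 'rV[rat]_d, finite_set A &
    (forall q, A q -> `|qpt q| <= K + 1) /\
    (forall x, `|x| <= K -> exists2 q, A q & `|x - qpt q| <= r).
Proof.
(* The summand 1 makes the mesh [1 / m] at most 1 as well as at most [r], so the grid points needed
   have norm at most [K + 1]. *)
move=> r0 K0; pose m := (Num.truncn (1 + r^-1)).+1.
have m0 : 0 < m%:R :> R by rewrite ltr0n.
have mr : 1 + r^-1 <= m%:R by rewrite ltW// truncnS_gt.
have rV : 0 < r^-1 by rewrite invr_gt0.
have m1 : m%:R^-1 <= 1 :> R by rewrite invf_le1//; lra.
have mr' : m%:R^-1 <= r by rewrite -[leRHS]invrK lef_pV2 ?posrE//; lra.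
pose g (z : 'rV[int]_d) : 'rV[rat]_d := map_mx (fun a : int => a%:~R / m%:R) z.
have gE z i : (qpt (g z)) 0 i = (z 0 i)%:~R / m%:R.
  by rewrite !mxE rmorphM/= fmorphV/= ratr_int ratr_nat.
pose B := (Num.truncn (m%:R * (K + 1))).+1.
pose A := [set q | (exists2 z : 'rV[int]_d, (forall i, `|z 0 i| <= B%:Z) & g z = q) /\ `|qpt q| <= K + 1].
exists A.
  apply: (@sub_finite_set _ _ (g @` [set z : 'rV[int]_d | forall i, `|z 0 i| <= B%:Z])).
    by move=> q [[z zB <-] _]; exists z.
  exact/finite_image/finite_int_box.
split; first by move=> q [].
move=> x xK; pose z : 'rV[int]_d := \row_i Num.floor (m%:R * x 0 i).
have zx i : `|x 0 i - (qpt (g z)) 0 i| <= m%:R^-1.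
  rewrite gE mxE; have /andP[f1 f2] := floor_itv (m%:R * x 0 i).
  have -> : x 0 i - (Num.floor (m%:R * x 0 i))%:~R / m%:R =
    (m%:R * x 0 i - (Num.floor (m%:R * x 0 i))%:~R) / m%:R by field; rewrite gt_eqF.
  rewrite normrM normfV (gtr0_norm m0) ler_piMl ?invr_ge0 ?(ltW m0)//.
  by move: f2; rewrite intrD ler_norml => f2; apply/andP; split; lra.
have xq : `|x - qpt (g z)| <= m%:R^-1.
  by apply: row_norm_le => [|i]; [rewrite invr_ge0 ltW|have := zx i; rewrite !mxE].
have qK : `|qpt (g z)| <= K + 1.
  rewrite -[qpt (g z)](subrK x); apply: le_trans (ler_normD _ _) _.
  by rewrite addrC distrC lerD// (le_trans xq).
exists (g z); last exact: le_trans xq mr'.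
split=> //; exists z => // i.
have := le_trans (row_coord_le (qpt (g z)) i) qK.
rewrite gE normrM normfV (gtr0_norm m0) ler_pdivrMr// mulrC => h.
have := le_lt_trans h (truncnS_gt _); rewrite -intr_norm -[X in _ < X]mulrz_nat ltr_int natz.
exact: ltW.
Qed.

(** The constants are chosen in turn: [T2], then [K] from [T2], then the radius [r] from both, then
    a finite grid of mesh at most [r], whose thresholds have a common bound. In the tails both terms
    are nonnegative and at most [k0], hence so is the absolute value of their difference. *)
Lemma uniform_local_limit (k0 : R) : 0 < k0 ->
  exists N, forall n, (N <= n)%N -> forall (x : 'rV[R]_d) t, T1 <= t ->
    `|sq n ^+ d * hat (Num.truncn (n%:R * t)) (point n x)
        - 2 * aG^-1 * gauss D t x| <= k0.
Proof.
move=> k00; have [T2 T12 [N1 H1]] := time_tail k00.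
have [K K0 [N2 H2]] := space_tail k00 T12.
have K10 : 0 <= K + 1 by lra.
have [r r0 H3] := compact_eventually_near_rational k00 K10 T12.
have [A fA [AK AX]] := rational_grid r0 K0.
have [N3 H3'] := finite_eventually fA (fun q Aq => H3 q (AK q Aq)).
exists (maxn (maxn N1 N2) N3) => n.
rewrite !geq_max => /andP[/andP[n1 n2] n3] x t t1.
have dist_le (a b : R) : 0 <= a -> 0 <= b -> a <= k0 /\ b <= k0 -> `|a - b| <= k0.
  by move=> a0 b0 [ak bk]; rewrite ler_norml; apply/andP; split; lra.
have a0 : 0 <= sq n ^+ d * hat (Num.truncn (n%:R * t)) (point n x).
  by rewrite mulr_ge0 ?exprn_ge0 ?sqrtr_ge0// hat_ge0//; exact: point_in.
have b0 : 0 <= 2 * aG^-1 * gauss D t x.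
  by rewrite mulr_ge0 ?gauss_ge0// mulr_ge0// invr_ge0 ltW.
have [tT2|tT2] := leP T2 t; first exact/dist_le/H1.
have t12 : T1 <= t <= T2 by rewrite t1 ltW.
have [Kx|Kx] := leP K `|x|; first exact/dist_le/H2.
by have [q Aq xq] := AX x (ltW Kx); exact: (H3' n n3 q Aq).
Qed.

End LocalLimit.

Theorem theorem4p5 (R : realType) (d : nat) (G : lattice_graph d)
    (CM CU : R) (mu : 'rV[int]_d -> 'rV[int]_d -> R)
    (disp : measure_display) (Omega : measurableType disp)
    (P : 'rV[int]_d -> probability Omega R)
    (X : nat -> Omega -> 'rV[int]_d)
    (le : rel 'rV[int]_d)
    (T1 D delta CH C1 C2 C3 C4 aG : R) (s : 'rV[int]_d -> R) :
  (2 <= d)%N ->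
  infinite_set (vset G) -> graph_connected G -> vset G 0 ->
  conductances G CM mu ->
  (forall x r, vset G x -> 1 <= r -> vol G mu (gball G x r) <= CU * r ^+ d) ->
  markov_chain G mu P X ->
  total le -> antisymmetric le -> transitive le ->
  0 < T1 ->
  [/\ 0 < D, 0 < delta & 0 < CH] ->
  [/\ 0 < C1, 0 < C2, 0 < C3, 0 < C4 & 0 < aG] ->
  (* (a) *)
  (forall (I : set R) (y : 'rV[R]_d) (r : R),
     compact I -> I `<=` [set t | 0 < t] -> 0 < r ->
     {uniform I,
       (fun (n : nat) (t : R) =>
          fine (P 0 [set w | cube y r (rescaled X n t w)])) @ \oo -->
       (fun t : R => integral_cube y r (gauss D t))}) ->
  (* (b) *)
  (forall (k : nat) (x : 'rV[int]_d), C3 <= k%:R -> vset G x ->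
     heat_kernel_hat G mu P X k%:R 0 x <=
       C2 * k%:R `^ (- (d%:R / 2))
       * expR (- (C4 * (gdist G 0 x)%:R ^+ 2 / k%:R))) ->
  (* (c) *)
  (forall (y : 'rV[int]_d) (rho : R), vset G y -> s y <= rho ->
     PHI G mu CH y rho (rho ^+ 2)) ->
  (* (d) *)
  hole G r / r @[r --> +oo%R] --> (0 : R) ->
  (* (e) *)
  (forall q : 'rV[rat]_d,
     let x : 'rV[R]_d := map_mx ratr q in
     [/\ forall r : R, 0 < r ->
           vol G mu (Lam_n G n x r) / (2 * Num.sqrt n%:R * r) ^+ d
             @[n --> \oo] --> aG,
         forall r : R, 0 < r ->
           exists n0 : nat, forall n : nat, (n0 <= n)%N ->
             forall x' y', Lam_n G n x r x' -> Lam_n G n x r y' ->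
               `|emb R x' - emb R y'| <= (gdist G x' y')%:R
               /\ (gdist G x' y')%:R <=
                  Num.max (C1 * `|emb R x' - emb R y'|)
                          (n%:R `^ (1 / 2 - delta)) &
         (Num.sqrt n%:R)^-1 * s (closest G le n x) @[n --> \oo] --> (0 : R)]) ->
  ereal_sup
    [set ereal_sup
           [set (`| n%:R `^ (d%:R / 2)
                    * heat_kernel_hat G mu P X (n%:R * t) 0 (closest G le n x)
                    - 2 * aG^-1 * gauss D t x |)%:E | t in [set t | T1 <= t]]
    | x in [set: 'rV[R]_d]] @[n --> \oo] --> 0%E.
Proof.
move=> d2 G_inf G_conn G0 cond _ chain le_tot _ le_tr T1_gt0 [D0 delta0 CH0].
move=> [C10 C20 C30 C40 aG0] clt gb phi holes rat.
pose dist n x t := `| n%:R `^ (d%:R / 2)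
    * heat_kernel_hat G mu P X (n%:R * t) 0 (closest G le n x)
    - 2 * aG^-1 * gauss D t x |.
pose S n := ereal_sup [set ereal_sup [set (dist n x t)%:E | t in [set t | T1 <= t]]
  | x in [set: 'rV[R]_d]].
rewrite -[X in X @ \oo --> _]/S.
(* Nonnegativity rules out minus infinity; together with an upper bound it makes [S n] eventually
   finite, as [fine_cvgP] demands. *)
have S_ge0 n : (0 <= S n)%E.
  apply: (@le_trans _ _ (dist n 0 T1)%:E); first by rewrite lee_fin normr_ge0.
  apply: (@le_trans _ _ (ereal_sup [set (dist n 0 t)%:E | t in [set t | T1 <= t]])).
    by apply: ereal_sup_ubound; exists T1 => /=.
  by apply: ereal_sup_ubound; exists 0.
have S_le e : 0 < e -> exists N, forall n, (N <= n)%N -> (S n <= e%:E)%E.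
  move=> e0; have [N HN] := uniform_local_limit d2 G_inf G_conn G0 cond chain
    le_tot le_tr T1_gt0 D0 delta0 CH0 C10 C20 C30 C40 aG0 clt gb phi holes rat e0.
  exists N => n Nn; apply: ge_ereal_sup => _ [x _ <-].
  apply: ge_ereal_sup => _ [t /= Tt <-]; rewrite lee_fin /dist powR_half.
  rewrite (heat_kernel_hatE G_inf G_conn G0 cond chain); first exact: HN.
  exact: point_in.
have S_fin n e : (S n <= e%:E)%E -> S n \is a fin_num.
  by move=> Se; rewrite ge0_fin_numE//; apply: le_lt_trans Se (ltry _).
apply/fine_cvgP; split.
  by have [N HN] := S_le 1 ltr01; exists N => // n /= /HN; exact: S_fin.
apply/cvgrPdist_le => e e0; have [N HN] := S_le e e0.
exists N => // n /= Nn; rewrite sub0r normrN ger0_norm ?fine_ge0//.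
by rewrite -lee_fin fineK ?(S_fin n e)// HN.
Qed.
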